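(* Let $\Gamma_M$ be a perfect matching graph of a connected trivalent ribbon graph $\Gamma$ with perfect matching $M$. Let $n\in \mathbb{N}$ and let $\mathbb{k}$ be a ring in which $\sqrt{n}$ is defined. Then there exists a spectral sequence $(E_r(\Gamma_M),d_r)$ such that the $E_1$-page is isomorphic to the bigraded $n$-color homology $CH^{*,*}_n(\Gamma_M;\mathbb{k})$ and the $E_\infty$-page is isomorphic to the filtered $n$-color homology $\widehat{CH}_n(\Gamma_M;\mathbb{k})$.
   Context: Graphs are finite multigraphs. A ribbon graph $\Gamma$ of a connected graph $G$ is a compact surface with boundary containing $G$ (as a 1-dimensional CW complex) that deformation retracts onto $G$; equivalently one disk per vertex and one band per edge. A perfect matching graph $\Gamma_M$ is a ribbon graph of a trivalent graph together with a perfect matching $M=\{e_1,\dots,e_\ell\}$ (every vertex is incident to exactly one edge of $M$). States: for $e\in M$ with ends $u,v$, each of the two sides of the band of $e$ runs at $u$ next to exactly one of the two other half-edges at $u$, and at $v$ next to exactly one of the two other half-edges at $v$; so the sides of $e$ pair the remaining half-edges at $u$ with those at $v$. The 0-smoothing at $e$ deletes $e,u,v$ and joins half-edges by this pairing; the 1-smoothing joins them by the other pairing. For $\alpha\in\{0,1\}^\ell$ the state $\Gamma_\alpha$ is the set of circles obtained by performing the $\alpha_i$-smoothing at every $e_i$; $k_\alpha$ is its number of circles, $|\alpha|=\sum\alpha_i$. If $\alpha'$ is obtained from $\alpha$ by changing one $0$ (in position $p$) to $1$, then passing from $\Gamma_\alpha$ to $\Gamma_{\alpha'}$ either fuses two circles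 into one, splits one circle into two, or changes one circle to one circle. Put $m=\lfloor n/2\rfloor$. ''A ring in which $\sqrt n$ is defined'' means a ring containing a square root of $n$ (for example $\mathbb{R}$ or $\mathbb{C}$, or $\mathbb{Z}$ when $n$ is a perfect square). Bigraded theory: $V=\mathbb{k}[x]/(x^n)$ with $\deg x^k=m-k$ $(0\le k\le n-1)$; $V_\alpha=V^{\otimes k_\alpha}\{m|\alpha|\}$ (one factor per circle; $\{s\}$ raises degrees by $s$); $C^{i,*}(\Gamma_M)=\bigoplus_{|\alpha|=i}V_\alpha$ with second grading $j$ the shifted degree. The edge map $\partial_{\alpha\alpha'}:V_\alpha\to V_{\alpha'}$ is the identity on unaffected circles and on the affected ones is, in the fuse/split/one-to-one case respectively, multiplication in $V$; $\Delta(x^k)=\sum_{i+j=k+2m,\,0\le i,j\le n-1}x^i\otimes x^j$; $\eta(x^k)=\sqrt n\,x^{k+m}$. The differential is $\partial|_{V_\alpha}=\sum_{\alpha'}(-1)^{\alpha_1+\dots+\alpha_{p-1}}\partial_{\alpha\alpha'}$, of bidegree $(1,0)$, and $CH_n^{i,j}(\Gamma_M;\mathbb k)$ is the homology of $(C^{*,*}(\Gamma_M),\partial)$. Filtered theory: the same construction with $\widehat V=\mathbb{k}[x]/(x^n-1)$ in place of $V$ (as a module with basis $1,\dots,x^{n-1}$ of the same degrees), and edge maps $\widehat m(x^i\otimes x^j)=x^{i+j}$; $\widehat\Delta(x^k)=\sum_{0\le i,j<n,\ i+j\equiv k+2m \bmod n}x^i\otimes x^j$; $\widehat\eta(x^k)=\sqrt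 n\,x^{k+m}$ (with $x^n=1$), giving a differential $\widehat\partial=\partial+\widetilde\partial$, where $\widetilde\partial$ has bidegree $(1,n)$; thus $\widehat\partial$ raises $i$ by one and does not decrease the quantum degree $j$, hence is filtered with respect to $j$. $\widehat{CH}^*_n(\Gamma_M;\mathbb{k})$ is the homology of this complex. The spectral sequence is the one attached to this filtered complex: $E_0=C^{*,*}(\Gamma_M)$, $d_0=\partial$, and $d_r$ has bidegree $(1,rn)$. *)

(* Defs.v *)
From HB Require Import structures.
From mathcomp Require Import all_boot all_order all_fingroup all_algebra.
From mathcomp Require Import boolp.

Set Implicit Arguments.
Unset Strict Implicit.
Unset Printing Implicit Defensive.

Import GRing.Theory.
Local Open Scope ring_scope.

Section Submodules.
Variables (k : pzRingType) (V : lmodType k).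

Section Of.
Variables (P : V -> Prop) (P0 : P 0)
  (PZD : forall a u v, P u -> P v -> P (a *: u + v)).

Definition submod_pred : {pred V} := fun v => `[< P v >].

Fact submod_pred_closed : submod_closed submod_pred.
Proof.
split=> [|a u v /asboolP Pu /asboolP Pv]; apply/asboolP; first exact: P0.
exact: PZD.
Qed.

HB.instance Definition _ :=
  GRing.isSubmodClosed.Build k V submod_pred submod_pred_closed.

Definition submod_of : submodClosed V := submod_pred.

Lemma submod_ofP v : reflect (P v) (v \in submod_of).
Proof. exact: asboolP. Qed.
End Of.

Lemma submodN (S : submodClosed V) v : (- v \in S) = (v \in S).
Proof.
have sN w : w \in S -> - w \in S by move=> wS; rewrite -scaleN1r rpredZ.
by apply/idP/idP => [/sN|/sN //]; rewrite opprK.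
Qed.

Section Add.
Variables S T : submodClosed V.

Fact capS_closed a u v : u \in S /\ u \in T -> v \in S /\ v \in T ->
  a *: u + v \in S /\ a *: u + v \in T.
Proof. by move=> [uS uT] [vS vT]; split; rewrite rpredD ?rpredZ. Qed.
Definition capS : submodClosed V :=
  submod_of (conj (rpred0 S) (rpred0 T)) capS_closed.

Fact addS0 : exists s t, [/\ s \in S, t \in T & 0 = s + t].
Proof. by exists 0, 0; rewrite !rpred0 addr0. Qed.
Fact addS_closed a u v :
  (exists s t, [/\ s \in S, t \in T & u = s + t]) ->
  (exists s t, [/\ s \in S, t \in T & v = s + t]) ->
  exists s t, [/\ s \in S, t \in T & a *: u + v = s + t].
Proof.
move=> [s [t [sS tT ->]]] [s' [t' [sS' tT' ->]]].
exists (a *: s + s'), (a *: t + t').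
by rewrite !rpredD ?rpredZ // scalerDr addrACA.
Qed.
Definition addS : submodClosed V := submod_of addS0 addS_closed.
End Add.
End Submodules.

Section LinearSubmodules.
Variables (k : pzRingType) (U V : lmodType k) (f : {linear U -> V}).

Fact imS_0 (S : submodClosed U) : exists2 w, w \in S & 0 = f w.
Proof. by exists 0; rewrite ?rpred0 ?linear0. Qed.
Fact imS_closed (S : submodClosed U) a u v :
  (exists2 w, w \in S & u = f w) -> (exists2 w, w \in S & v = f w) ->
  exists2 w, w \in S & a *: u + v = f w.
Proof.
move=> [w wS ->] [w' wS' ->]; exists (a *: w + w'); last by rewrite linearP.
by rewrite rpredD ?rpredZ.
Qed.
Definition imS S : submodClosed V := submod_of (imS_0 S) (@imS_closed S).

Fact preimS_0 (T : submodClosed V) : f 0 \in T.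
Proof. by rewrite linear0 rpred0. Qed.
Fact preimS_closed (T : submodClosed V) a u v :
  f u \in T -> f v \in T -> f (a *: u + v) \in T.
Proof. by move=> fu fv; rewrite linearP rpredD ?rpredZ. Qed.
Definition preimS T : submodClosed U :=
  submod_of (preimS_0 T) (@preimS_closed T).

Fact kerS_closed a u v : f u = 0 -> f v = 0 -> f (a *: u + v) = 0.
Proof. by move=> fu fv; rewrite linearP fu fv scaler0 addr0. Qed.
Definition kerS : submodClosed U := submod_of (linear0 f) kerS_closed.

Fact limS_0 : exists w, 0 = f w.
Proof. by exists 0; rewrite linear0. Qed.
Fact limS_closed a u v : (exists w, u = f w) -> (exists w, v = f w) ->
  exists w, a *: u + v = f w.
Proof. by move=> [w ->] [w' ->]; exists (a *: w + w'); rewrite linearP. Qed.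
Definition limS : submodClosed V := submod_of limS_0 limS_closed.
End LinearSubmodules.

(* The subquotient Z / (Z :&: B); when B is contained in Z it is Z / B. *)
Section Subquotient.
Local Open Scope quotient_scope.
Variables (k : pzRingType) (V : lmodType k) (Z B : submodClosed V).

Record submodule := Submodule { submodule_val : V; _ : submodule_val \in Z }.
HB.instance Definition _ := [isSub for submodule_val].
HB.instance Definition _ := [Choice of submodule by <:].
HB.instance Definition _ := [SubChoice_isSubLmodule of submodule by <:].

Definition subq_rel (x y : submodule) := val x - val y \in B.

Fact subq_refl : reflexive subq_rel.
Proof. by move=> x; rewrite /subq_rel subrr rpred0. Qed.
Fact subq_sym : symmetric subq_rel.
Proof. by move=> x y; rewrite /subq_rel -opprB submodN. Qed.
Fact subq_trans : transitive subq_rel.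
Proof.
move=> y x z xy yz; rewrite /subq_rel -(subrK (val y) (val x)) -addrA.
exact: rpredD.
Qed.
Canonical subq_equiv := EquivRel subq_rel subq_refl subq_sym subq_trans.

Definition subquot := {eq_quot subq_rel}.
HB.instance Definition _ := Choice.on subquot.
HB.instance Definition _ := EqQuotient.on subquot.

Lemma subq_eq x y : (\pi_subquot x == \pi_subquot y) = (val x - val y \in B).
Proof. by rewrite piE. Qed.

Definition subq_zero : subquot := lift_cst subquot 0.
Definition subq_add := lift_op2 subquot +%R.
Definition subq_opp := lift_op1 subquot -%R.
Definition subq_scale (a : k) := lift_op1 subquot ( *:%R a).

Canonical pi_subq_zero := PiConst subq_zero.
Fact pi_subq_add : {morph \pi : x y / x + y >-> subq_add x y}.
Proof.
move=> x y; unlock subq_add; apply/eqP.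
rewrite subq_eq /= opprD addrACA.
by rewrite rpredD // -subq_eq reprK.
Qed.
Canonical pi_subq_add_morph := PiMorph2 pi_subq_add.
Fact pi_subq_opp : {morph \pi : x / - x >-> subq_opp x}.
Proof.
move=> x; unlock subq_opp; apply/eqP.
by rewrite subq_eq /= -opprD submodN -subq_eq reprK.
Qed.
Canonical pi_subq_opp_morph := PiMorph1 pi_subq_opp.
Fact pi_subq_scale a : {morph \pi : x / a *: x >-> subq_scale a x}.
Proof.
move=> x; unlock subq_scale; apply/eqP.
by rewrite subq_eq /= -scalerBr rpredZ // -subq_eq reprK.
Qed.
Canonical pi_subq_scale_morph a := PiMorph1 (pi_subq_scale a).

Fact subq_addA : associative subq_add.
Proof.
by elim/quotW=> x; elim/quotW=> y; elim/quotW=> z; rewrite !piE addrA.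
Qed.
Fact subq_addC : commutative subq_add.
Proof. by elim/quotW=> x; elim/quotW=> y; rewrite !piE addrC. Qed.
Fact subq_add0 : left_id subq_zero subq_add.
Proof. by elim/quotW=> x; rewrite !piE add0r. Qed.
Fact subq_addN : left_inverse subq_zero subq_opp subq_add.
Proof. by elim/quotW=> x; rewrite !piE addNr. Qed.
HB.instance Definition _ :=
  GRing.isZmodule.Build subquot subq_addA subq_addC subq_add0 subq_addN.

Fact subq_scaleA a b v :
  subq_scale a (subq_scale b v) = subq_scale (a * b) v.
Proof. by elim/quotW: v => x; rewrite !piE scalerA. Qed.
Fact subq_scale1 : left_id 1 subq_scale.
Proof. by elim/quotW=> x; rewrite !piE scale1r. Qed.
Fact subq_scaleDr : right_distributive subq_scale +%R.
Proof.
move=> a; elim/quotW=> x; elim/quotW=> y.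
by rewrite /GRing.add /= !piE scalerDr.
Qed.
Fact subq_scaleDl v : {morph subq_scale^~ v : a b / a + b}.
Proof.
by elim/quotW: v => x a b; rewrite /GRing.add /= !piE scalerDl.
Qed.
HB.instance Definition _ := GRing.Zmodule_isLmodule.Build k subquot
  subq_scaleA subq_scale1 subq_scaleDr subq_scaleDl.

(* The class of v, with the junk value 0 when v is not in Z. *)
Definition cls (v : V) : subquot := \pi_subquot (insubd (0 : submodule) v).
End Subquotient.

Section ClassLinear.
Local Open Scope quotient_scope.
Variables (k : pzRingType) (V : lmodType k) (Z B : submodClosed V).

Lemma cls0 : cls Z B 0 = 0.
Proof.
have -> : 0 = \pi_(subquot Z B) (0 : submodule Z) :> subquot Z B.
  by rewrite [LHS]/GRing.zero /= piE.
by congr (\pi _); apply: val_inj; rewrite val_insubd rpred0.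
Qed.

Lemma clsP a u v : u \in Z -> v \in Z ->
  cls Z B (a *: u + v) = a *: cls Z B u + cls Z B v.
Proof.
move=> uZ vZ; have uvZ : a *: u + v \in Z by rewrite rpredD ?rpredZ.
rewrite [RHS]/GRing.add [a *: cls _ _ _]/GRing.scale /= /cls !piE.
congr (\pi _); apply: val_inj.
transitivity (a *: val (insubd (0 : submodule Z) u)
              + val (insubd (0 : submodule Z) v)); last by [].
by rewrite !val_insubd uZ vZ uvZ.
Qed.
End ClassLinear.

Definition lmod_iso (k : pzRingType) (U V : lmodType k) : Prop :=
  exists f : {linear U -> V}, bijective f.

(* ker g / im f, for composable maps with g \o f = 0. *)
Definition homology (k : pzRingType) (U V W : lmodType k)
    (f : {linear U -> V}) (g : {linear V -> W}) : lmodType k :=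
  subquot (kerS g) (limS f).

(* A cohomological spectral sequence with d_r of bidegree (1, r * n).  Every
   bidegree has the form (i + 1, j + r * n), so [turn] covers all of them. *)
Record spectralSequence (k : pzRingType) (n : nat) := SpectralSequence {
  page : nat -> int -> int -> lmodType k;
  diff : forall r i j,
    {linear page r i j -> page r (i + 1) (j + (r * n)%N%:Z)};
  diff_diff : forall r i j (x : page r i j), diff r _ _ (diff r i j x) = 0;
  turn : forall r i j,
    {linear homology (diff r i j) (diff r (i + 1) (j + (r * n)%N%:Z))
      -> page r.+1 (i + 1) (j + (r * n)%N%:Z)};
  turn_bij : forall r i j, bijective (turn r i j) }.

(* From the R-th page on the differentials vanish, so that the pages are
   constant and E_infinity is page R. *)
Definition degenerates_at (k : pzRingType) (n : nat)
    (E : spectralSequence k n) (R : nat) : Prop :=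
  forall r i j (x : page E r i j), (R <= r)%N -> diff E r i j x = 0.

Definition Einfty_iso (k : pzRingType) (n : nat) (E : spectralSequence k n)
    (A : int -> int -> lmodType k) : Prop :=
  exists R, degenerates_at E R /\ forall i j, lmod_iso (page E R i j) (A i j).

(* The free module on a finite set X of generators, each with a homological
   degree and a quantum degree. *)
Section BigradedModule.
Variables (k : comPzRingType) (X : finType) (hdeg qdeg : X -> int).

Definition chains : lmodType k := {ffun X -> k^o}.

Definition matrix_fun (a : X -> X -> k) (v : chains) : chains :=
  [ffun y => \sum_x a x y * v x].
Fact matrix_fun_linear a : linear (matrix_fun a).
Proof.
move=> c u v; apply/ffunP=> y; rewrite !ffunE scaler_sumr -big_split /=.
apply: eq_bigr => x _; rewrite !ffunE mulrDr; congr (_ + _).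
by rewrite /GRing.scale /= mulrCA.
Qed.
HB.instance Definition _ a :=
  GRing.isLinear.Build k chains chains *:%R (matrix_fun a)
    (matrix_fun_linear a).

(* The endomorphism sending the generator x to \sum_y a x y *: y. *)
Definition matrix_map (a : X -> X -> k) : {linear chains -> chains} :=
  matrix_fun a.

Fact spanS_0 (P : pred X) x : (0 : chains) x != 0 -> P x.
Proof. by rewrite ffunE eqxx. Qed.
Fact spanS_closed (P : pred X) a (u v : chains) :
  (forall x, u x != 0 -> P x) -> (forall x, v x != 0 -> P x) ->
  forall x, (a *: u + v) x != 0 -> P x.
Proof.
move=> uP vP x; rewrite !ffunE; apply: contraR => nPx.
have /eqP-> : u x == 0 by apply: contraR nPx; exact: uP.
have /eqP-> : v x == 0 by apply: contraR nPx; exact: vP.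
by rewrite scaler0 addr0.
Qed.
Definition spanS (P : pred X) : submodClosed chains :=
  submod_of (@spanS_0 P) (@spanS_closed P).

Definition hpart (i : int) := spanS [pred x | hdeg x == i].
Definition bipart (i j : int) :=
  spanS [pred x | (hdeg x == i) && (qdeg x == j)].
Definition fil (i j : int) := spanS [pred x | (hdeg x == i) && (j <= qdeg x)].

Variable D : {linear chains -> chains}.

(* Homology of a bigraded differential D, of bidegree (1, 0). *)
Definition bihomology (i j : int) : lmodType k :=
  subquot (capS (bipart i j) (kerS D)) (imS D (bipart (i - 1) j)).

(* Homology of a filtered differential D, with its induced filtration and the
   associated graded modules F^j H^i / F^(j+1) H^i. *)
Definition fhomology (i : int) : lmodType k :=
  subquot (capS (hpart i) (kerS D)) (imS D (hpart (i - 1))).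

Fact filH_0 i j : exists2 v : chains, v \in capS (fil i j) (kerS D) &
  0 = cls (capS (hpart i) (kerS D)) (imS D (hpart (i - 1))) v.
Proof. by exists 0; rewrite ?rpred0 ?cls0. Qed.

Lemma fil_sub i j v : v \in capS (fil i j) (kerS D) ->
  v \in capS (hpart i) (kerS D).
Proof.
move=> /submod_ofP[/submod_ofP vF vD]; apply/submod_ofP; split=> //.
by apply/submod_ofP => x /vF /andP[].
Qed.

Fact filH_closed i j a (x y : fhomology i) :
  (exists2 v : chains, v \in capS (fil i j) (kerS D) & x = cls _ _ v) ->
  (exists2 v : chains, v \in capS (fil i j) (kerS D) & y = cls _ _ v) ->
  exists2 v : chains, v \in capS (fil i j) (kerS D) & a *: x + y = cls _ _ v.
Proof.
move=> [u uF ->] [v vF ->]; exists (a *: u + v).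
  by rewrite rpredD ?rpredZ.
by rewrite clsP //; apply: fil_sub; eassumption.
Qed.

Definition filH (i j : int) : submodClosed (fhomology i) :=
  submod_of (filH_0 i j) (@filH_closed i j).

Definition grH (i j : int) : lmodType k :=
  subquot (filH i j) (filH i (j + 1)).

(* The terms of the spectral sequence of the filtered complex (chains, D):
   Z_s^(i,j) = {v in F^j C^i | D v in F^(j+s) C^(i+1)} and
   E_s^(i,j) = Z_s^(i,j) / (Z_(s-1)^(i,j+1) + D Z_(s-1)^(i-1,j-s+1)). *)
Definition fZ (s i j : int) : submodClosed chains :=
  capS (fil i j) (preimS D (fil (i + 1) (j + s))).
Definition fB (s i j : int) : submodClosed chains :=
  addS (fZ (s - 1) i (j + 1)) (imS D (fZ (s - 1) (i - 1) (j - s + 1))).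
Definition fpage (s i j : int) : lmodType k := subquot (fZ s i j) (fB s i j).

(* E is the spectral sequence of the filtered complex (chains, D), reindexed so
   that its r-th page is the (r * n)-th page for the filtration in steps of 1:
   d_r is induced by D, and the identification of H(E_r) with E_(r+1) is the
   identity on representatives. *)
Definition attached (n : nat) (E : spectralSequence k n) : Prop :=
  exists phi : forall r i j,
      {linear page E r i j -> fpage (r * n)%N%:Z i j},
    [/\ forall r i j, bijective (phi r i j),
        forall r i j (x : page E r i j) (v : chains),
          v \in fZ (r * n)%N%:Z i j -> phi r i j x = cls _ _ v ->
          phi r _ _ (diff E r i j x) = cls _ _ (D v)
      & forall r i j (x : page E r (i + 1) (j + (r * n)%N%:Z)) (v : chains),
          v \in fZ (r.+1 * n)%N%:Z (i + 1) (j + (r * n)%N%:Z) ->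
          phi r _ _ x = cls _ _ v ->
          phi r.+1 _ _ (turn E r i j (cls _ _ x)) = cls _ _ v].
End BigradedModule.

(* A ribbon graph as a signed rotation system.  The darts are the half-edges;
   after a choice of orientation of each vertex disk, [rotation] sends a
   half-edge to the next one around its vertex, so that the vertices are the
   orbits of [rotation].  [mate] exchanges the two halves of an edge, and
   [twist] tells whether the band of the edge is attached with a half-twist
   relative to the orientations of the disks at its ends.  Every ribbon graph
   (orientable or not, loops and multiple edges allowed) without isolated
   vertices arises this way. *)
Record ribbonGraph := RibbonGraph {
  dart : finType;
  rotation : {perm dart};
  mate : dart -> dart;
  twist : dart -> bool;
  mateK : involutive mate;
  mate_neq : forall x, mate x != x;
  twist_mate : forall x, twist (mate x) = twist x }.

Section RibbonGraph.
Variable G : ribbonGraph.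
Implicit Types (x y h : dart G).

Definition vertex x : {set dart G} := porbit (rotation G) x.

Definition edges : {set {set dart G}} := [set [set x; mate x] | x : dart G].

Definition connected : Prop :=
  exists x, forall y,
    connect [rel u v | (v == rotation G u) || (v == mate u)] x y.

Definition trivalent : Prop := forall x, #|vertex x| = 3%N.

Definition rotV x : dart G := (rotation G)^-1%g x.

Section Matching.
Variables (l : nat) (M : l.-tuple {set dart G}).

Definition matched x : bool := [exists p, x \in tnth M p].

(* Counting half-edges rather than edges rules out loops in M. *)
Definition perfect_matching : Prop :=
  [/\ uniq M, {subset M <= edges} &
      forall x, #|[set y in vertex x | matched y]| = 1%N].

Definition resolution := {ffun 'I_l -> bool}.

(* In the next two definitions x is an unmatched half-edge of a trivalent
   graph, and [mdart x] is the matched half-edge at the vertex of x. *)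
Definition mdart x : dart G :=
  if matched (rotation G x) then rotation G x else rotV x.

(* The half-edge joined to x when the matching edge e at x is smoothed.  If x
   follows h on the disk of its vertex then, for an untwisted band, the side of
   e next to x runs at the other end next to the predecessor of [mate h];
   a twist exchanges predecessor and successor, and so does a 1-smoothing. *)
Definition smooth (al : resolution) x : dart G :=
  let h := mdart x in
  let one := [exists p, (h \in tnth M p) && al p] in
  if (x == rotation G h) (+) twist h (+) one then rotV (mate h)
  else rotation G (mate h).

Definition circles (al : resolution) : {set {set dart G}} :=
  [set [set y | connect [rel u v | (v == mate u) || (v == smooth al u)] x y]
     | x in [set x | ~~ matched x]].

Definition circle (al : resolution) := {c : {set dart G} | c \in circles al}.

(* c runs through one of the half-edges adjacent to the p-th matching edge.
   When one circle is changed to one circle, both have the same half-edges. *)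
Definition affected (p : 'I_l) (c : {set dart G}) : bool :=
  [exists h in tnth M p, (rotation G h \in c) || (rotV h \in c)].

Section Theory.
Variables (k : comPzRingType) (n : nat) (sqrtn : k).

(* Basis of the tensor power of V (or of its filtered version) over the circles
   of a state: a generator labels each circle c with the exponent of x. *)
Definition labeling (al : resolution) := {ffun circle al -> 'I_n}.

(* The basis of the cochain module, over all states. *)
Definition generator := {al : resolution & labeling al}.

Definition weight (al : resolution) : nat := (\sum_p al p)%N.

Definition hdeg (b : generator) : int := (weight (tag b))%:Z.
Definition qdeg (b : generator) : int :=
  (\sum_c ((n./2)%:Z - (tagged b c : nat)%:Z)) + (n./2 * weight (tag b))%N%:Z.

(* Equality of exponents in k[x]/(x^n) (for [filtered = false]), where c < n so
   that a power x^e with n <= e contributes nothing, and in k[x]/(x^n - 1) (for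
   [filtered = true]). *)
Variable filtered : bool.
Definition exp_eq (e c : nat) : bool :=
  if filtered then (e == c %[mod n])%N else e == c.

(* Structure constants of the multiplication, of Delta and of eta. *)
Definition mul_coef (a b c : 'I_n) : k := (exp_eq (a + b) c)%:R.
Definition comul_coef (a b c : 'I_n) : k := (exp_eq (a + n./2.*2) (b + c))%:R.
Definition eta_coef (a c : 'I_n) : k := sqrtn * (exp_eq (a + n./2) c)%:R.

(* The entry at the generators f and g of the edge map changing the p-th
   smoothing from 0 to 1. *)
Definition edge_coef (p : 'I_l) (al be : resolution)
    (f : labeling al) (g : labeling be) : k :=
  if [forall c : circle al, forall d : circle be,
        (val c == val d) && ~~ affected p (val c) ==> (f c == g d)] then
    match enum [pred c : circle al | affected p (val c)],
          enum [pred d : circle be | affected p (val d)] with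
    | [:: c1; c2], [:: d] => mul_coef (f c1) (f c2) (g d)
    | [:: c], [:: d1; d2] => comul_coef (f c) (g d1) (g d2)
    | [:: c], [:: d] => eta_coef (f c) (g d)
    | _, _ => 0
    end
  else 0.

Definition covers (p : 'I_l) (al be : resolution) : bool :=
  ~~ al p && (be == [ffun q => (q == p) || al q]).

Definition diff_coef (b c : generator) : k :=
  \sum_(p < l | covers p (tag b) (tag c))
    (-1) ^+ (\sum_(q < l | (q < p)%N) tag b q)%N
      * edge_coef p (tagged b) (tagged c).
End Theory.

Section Homology.
Variables (k : comPzRingType) (n : nat) (sqrtn : k).

Definition ndiff : {linear chains k (generator n) -> chains k (generator n)} :=
  matrix_map (diff_coef sqrtn false).
Definition fdiff : {linear chains k (generator n) -> chains k (generator n)} :=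
  matrix_map (diff_coef sqrtn true).

(* CH_n^(i,j). *)
Definition CH (i j : int) : lmodType k :=
  bihomology (@hdeg n) (@qdeg n) ndiff i j.

(* The filtered homology in homological degree i, and the associated graded
   module of its filtration by quantum degree. *)
Definition hatCH (i : int) : lmodType k := fhomology (@hdeg n) fdiff i.
Definition gr_hatCH (i j : int) : lmodType k :=
  grH (@hdeg n) (@qdeg n) fdiff i j.
End Homology.
End Matching.
End RibbonGraph.

(* Main.v *)
(* The spectral sequence is the one of the filtration by quantum degree. Since
   the filtered differential is a sum of parts of degrees 0 and n, it commutes
   with the projections onto the residue classes of quantum degrees modulo n,
   so that the terms of the filtration change only every n steps; E_1 is the
   homology of the part of degree 0, and the filtration being finite the
   sequence degenerates to the graded homology.

   What has to be proved is that the filtered differential squares to zero,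
   for surfaces that need not be orientable. Over the algebraic numbers, put
   x = z_c, an n-th root of unity, on each circle c. An edge map then becomes
   diagonal: it is multiplication by 0 unless z takes a single value w on the
   affected circles, and otherwise by (sqrt n * w^m)^(1 + b - a) when it turns
   a circles into b. In the two composites around a square of states these
   factors multiply to the same number, because the total change in the number
   of circles is the same, or because the two smoothings do not interact. *)

Require Import Defs.
From HB Require Import structures.
From mathcomp Require Import all_boot all_order all_fingroup all_algebra.
From mathcomp Require Import all_field.
From mathcomp Require Import boolp zify ring.

Set Implicit Arguments.
Unset Strict Implicit.
Unset Printing Implicit Defensive.

Import Order.TTheory GRing.Theory Num.Theory.
Local Open Scope ring_scope.

(** * Submodules and subquotients *)

Section SubmoduleMembership.
Variables (k : pzRingType) (U V : lmodType k).
Implicit Types (S T : submodClosed V) (f : {linear U -> V}).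

Lemma mem_capS S T v : (v \in capS S T) = (v \in S) && (v \in T).
Proof. by apply/submod_ofP/andP. Qed.

Lemma addSP S T v :
  reflect (exists s t, [/\ s \in S, t \in T & v = s + t]) (v \in addS S T).
Proof. exact: submod_ofP. Qed.

Lemma imSP f (S : submodClosed U) v :
  reflect (exists2 w, w \in S & v = f w) (v \in imS f S).
Proof. exact: submod_ofP. Qed.

Lemma mem_preimS f T v : (v \in preimS f T) = (f v \in T).
Proof. by apply/submod_ofP/idP. Qed.

Lemma kerSP f v : reflect (f v = 0) (v \in kerS f).
Proof. exact: submod_ofP. Qed.

Lemma limSP f v : reflect (exists w, v = f w) (v \in limS f).
Proof. exact: submod_ofP. Qed.

Lemma submodB S u v : u \in S -> v \in S -> u - v \in S.
Proof. by move=> uS vS; rewrite rpredD // submodN. Qed.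
End SubmoduleMembership.

Section SubquotientMaps.
Local Open Scope quotient_scope.
Variables (k : pzRingType) (V : lmodType k) (Z B : submodClosed V).

Lemma clsE v (vZ : v \in Z) : cls Z B v = \pi_(subquot Z B) (Submodule vZ).
Proof. by congr (\pi _); apply: val_inj; rewrite val_insubd vZ. Qed.

Lemma cls_surj (x : subquot Z B) : exists2 v, v \in Z & x = cls Z B v.
Proof.
elim/quotW: x => -[v vZ]; exists v => //; by rewrite clsE.
Qed.

Lemma cls_eq u v : u \in Z -> v \in Z ->
  reflect (cls Z B u = cls Z B v) (u - v \in B).
Proof.
move=> uZ vZ; rewrite !clsE.
by have := subq_eq B (Submodule uZ) (Submodule vZ) => /= <-; exact: eqP.
Qed.

Lemma cls_eq0 v : v \in Z -> reflect (cls Z B v = 0) (v \in B).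
Proof.
move=> vZ; rewrite -[v in v \in B]subr0 -(cls0 Z B).
by apply: cls_eq; rewrite ?rpred0.
Qed.

Variables (W : lmodType k) (f : V -> W).
Hypothesis f_linear :
  forall a u v, u \in Z -> v \in Z -> f (a *: u + v) = a *: f u + f v.

(** The map is f at a chosen representative. Linearity is asked on [Z] only, because f will be built
    from class maps [cls], which are linear only there. The result is a sigma type, so that the map
    can serve as data of a spectral sequence. *)
Lemma subquot_map : (forall v, v \in Z -> v \in B -> f v = 0) ->
  {g : {linear subquot Z B -> W} | forall v, v \in Z -> g (cls Z B v) = f v}.
Proof.
move=> fB; pose g (x : subquot Z B) := f (val (generic_quotient.repr x)).
have valZ (y : submodule Z) : val y \in Z by case: y.
have gE v : v \in Z -> g (cls Z B v) = f v.
  move=> vZ; rewrite /g; set y := generic_quotient.repr _.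
  apply/eqP; rewrite -subr_eq0 addrC.
  have yB : val y - v \in B.
    by apply/cls_eq; rewrite ?valZ // clsE; rewrite [RHS]/cls -[RHS]reprK;
      congr (\pi _); apply: val_inj.
  have yvZ : val y - v \in Z by rewrite submodB ?valZ.
  have := f_linear 1 yvZ vZ; rewrite scale1r subrK => ->.
  by rewrite (fB _ yvZ yB) scaler0 add0r addNr.
have g_lin : linear g.
  move=> a x y; have [u uZ ->] := cls_surj x; have [v vZ ->] := cls_surj y.
  by rewrite -clsP // !gE ?rpredD ?rpredZ // f_linear.
pose L := GRing.isLinear.Build k (subquot Z B) W *:%R g g_lin.
by exists (HB.pack g L : {linear subquot Z B -> W}).
Qed.

Lemma subquot_map_bij (g : {linear subquot Z B -> W}) :
  (forall v, v \in Z -> g (cls Z B v) = f v) ->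
  (forall v, v \in Z -> f v = 0 -> v \in B) ->
  (forall w, exists2 v, v \in Z & f v = w) -> bijective g.
Proof.
move=> gE f0 fS; have gI : injective g.
  move=> x y; have [u uZ ->] := cls_surj x; have [v vZ ->] := cls_surj y.
  move=> /eqP; rewrite -subr_eq0 -linearB => /eqP guv.
  apply/cls_eq=> //; apply: f0; first exact: submodB.
  rewrite -gE ?submodB // -guv -[u - v]addrC -scaleN1r clsP //.
  by rewrite scaleN1r addrC.
have h w : {x | g x = w}.
  by apply: cid; have [v vZ <-] := fS w; exists (cls Z B v); rewrite gE.
exists (fun w => sval (h w)) => [x|w]; last exact: svalP (h w).
by apply: gI; exact: svalP (h (g x)).
Qed.
End SubquotientMaps.

(** The natural map between a page and the homology of the previous page starts from the page; the
    field [turn] needs its inverse. *)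
Lemma linear_inverse (k : pzRingType) (U V : lmodType k)
    (f : {linear U -> V}) : bijective f ->
  {g : {linear V -> U} | bijective g /\ cancel f g}.
Proof.
move=> f_bij; have [g [fK gK]] : {g | cancel f g /\ cancel g f}.
  by apply: cid; case: f_bij => g fK gK; exists g.
have g_lin : linear g.
  by move=> a x y; apply: (can_inj fK); rewrite linearP !gK.
pose L := GRing.isLinear.Build k V U *:%R g g_lin.
by exists (HB.pack g L : {linear V -> U}); split=> //; exists f.
Qed.

(** * The spectral sequence of a filtered complex *)

Section FilteredComplex.
Variables (k : comPzRingType) (X : finType) (hdeg qdeg : X -> int) (n : nat).
Variables (a b : X -> X -> k).
Hypothesis n_gt0 : (0 < n)%N.
Hypothesis a_deg : forall x y, a x y != 0 ->
  hdeg y = hdeg x + 1 /\ (qdeg y = qdeg x \/ qdeg y = qdeg x + n%:Z).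
Hypothesis bE : forall x y, b x y = if qdeg y == qdeg x then a x y else 0.

Notation C := (chains k X).
Notation D := (matrix_map a).
Notation N := (matrix_map b).
Notation fil := (fil k hdeg qdeg).
Notation fZ := (fZ hdeg qdeg D).
Notation fB := (fB hdeg qdeg D).
Notation fpage := (fpage hdeg qdeg D).
Implicit Types (u v w : C) (i j s : int).

Hypothesis DD : forall v, D (D v) = 0.

Lemma matrix_mapE c v y : matrix_map c v y = \sum_x c x y * v x.
Proof. by rewrite ffunE. Qed.

Lemma matrix_map_supp c v y :
  matrix_map c v y != 0 -> exists x, c x y != 0 /\ v x != 0.
Proof.
rewrite matrix_mapE => cv; have [x cvx|cv0] := pickP (fun x => c x y * v x != 0).
  exists x; split; apply: contraNneq cvx => ->; rewrite ?mul0r ?mulr0 //.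
by case/eqP: cv; rewrite big1 // => x _; apply/eqP; rewrite -[_ == _]negbK cv0.
Qed.

Lemma filP i j v :
  reflect (forall x, v x != 0 -> hdeg x = i /\ j <= qdeg x) (v \in fil i j).
Proof.
apply: (iffP (submod_ofP _ _ _)) => vF x /vF; first by move=> /andP[/eqP].
by move=> [hx le_j]; rewrite /= hx eqxx.
Qed.

Lemma fil_le i j i' j' v : i = i' -> j' <= j -> v \in fil i j -> v \in fil i' j'.
Proof.
move=> <- le_j /filP vF; apply/filP => x /vF[-> le_jx]; split=> //.
exact: le_trans le_jx.
Qed.

Lemma fZP s i j v : v \in fZ s i j = (v \in fil i j) && (D v \in fil (i + 1) (j + s)).
Proof. by rewrite /Defs.fZ mem_capS mem_preimS. Qed.

Lemma D_fil i j i' v : i' = i + 1 -> v \in fil i j -> D v \in fil i' j.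
Proof.
move=> -> /filP vF; apply/filP => y /matrix_map_supp[x [/a_deg[-> dq] /vF[-> le_jx]]].
split=> //; apply: le_trans le_jx _; case: dq => ->; lia.
Qed.

(** * Projections onto quantum degrees modulo n *)

Definition restrict (P : pred X) v : C := [ffun x => if P x then v x else 0].

Lemma restrictE P v x : restrict P v x = if P x then v x else 0.
Proof. by rewrite ffunE. Qed.

Lemma restrict_fil P i j v : v \in fil i j -> restrict P v \in fil i j.
Proof.
move=> /filP vF; apply/filP => x; rewrite restrictE.
by case: (P x) => [/vF|]; rewrite ?eqxx.
Qed.

Lemma restrictB P u v : restrict P (u - v) = restrict P u - restrict P v.
Proof.
by apply/ffunP => x; rewrite !ffunE; case: (P x); rewrite // subr0.
Qed.

Definition residue j : pred X := fun x => (n%:Z %| qdeg x - j)%Z.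

(** A nonzero entry of [a] changes the quantum degree by 0 or n, so it joins generators of the same
    residue class. *)
Lemma D_residue j v : D (restrict (residue j) v) = restrict (residue j) (D v).
Proof.
apply/ffunP => y; rewrite restrictE !matrix_mapE.
have -> : (if residue j y then \sum_x a x y * v x else 0)
  = \sum_x (if residue j y then a x y * v x else 0).
  by case: (residue j y); rewrite // big1.
apply: eq_bigr => x _; rewrite restrictE.
have [-> | axy] := eqVneq (a x y) 0; first by rewrite !mul0r if_same.
have -> : residue j y = residue j x.
  rewrite /residue; have [_ [->|->]] := a_deg axy; first by [].
  by rewrite addrAC rpredDr ?dvdzz.
by case: (residue j x); rewrite // mulr0.
Qed.

Lemma restrict_residueD j s v : (n%:Z %| s)%Z ->
  restrict (residue (j + s)) v = restrict (residue j) v.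
Proof.
move=> dvd_s; apply/ffunP => x; rewrite !restrictE /residue.
by rewrite opprD addrA (rpredBr _ dvd_s).
Qed.

(** In the residue class of j no degree lies strictly between j - n and j; the filtration of each
    class therefore jumps only every n steps. *)
Lemma dvdz_jump (q j : int) : (n%:Z %| q - j)%Z -> j - n%:Z < q -> j <= q.
Proof.
move=> /dvdzP[c qE] lt_q; have {}qE : q = j + c * n%:Z by rewrite -qE addrC subrK.
rewrite qE lerDl; have [c_ge0|c_lt0] := lerP 0 c; first by rewrite mulr_ge0.
have : c * n%:Z <= -1 * n%:Z by rewrite ler_wpM2r //; lia.
lia.
Qed.

Lemma residue_fil i j j' v : (forall q, (n%:Z %| q - j)%Z -> j' <= q -> j <= q) ->
  v \in fil i j' -> restrict (residue j) v \in fil i j.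
Proof.
move=> jump /filP vF; apply/filP => x; rewrite restrictE.
by case: ifP; rewrite ?eqxx // => /jump le_j /vF[-> /le_j].
Qed.

(** The part of quantum degree exactly j lies in the residue class of j and is removed. *)
Lemma residueC_fil i j v :
  v \in fil i j -> v - restrict (residue j) v \in fil i (j + 1).
Proof.
move=> /filP vF; apply/filP => x; rewrite !ffunE; case: ifP => [_|res].
  by rewrite subrr eqxx.
rewrite subr0 => /vF[-> le_j]; split=> //; move: res.
rewrite /residue; have [->|] := eqVneq (qdeg x) j; first by rewrite subrr dvdz0.
lia.
Qed.

(** * Pages, their differentials and the passage to the next page *)

Lemma cls_diff s i j : {d : {linear fpage s i j -> fpage s (i + 1) (j + s)} |
  forall v, v \in fZ s i j -> d (cls _ _ v) = cls _ _ (D v)}.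
Proof.
have DZ v : v \in fZ s i j -> D v \in fZ s (i + 1) (j + s).
  by rewrite !fZP DD rpred0 andbT => /andP[].
apply: (@subquot_map k C _ _ _ (fun v => cls _ _ (D v))) => [c u v uZ vZ|v vZ].
  by rewrite linearP clsP // DZ.
(* Since D squares to zero, D v = D z, and z is an admissible preimage for the denominator of the
   target. *)
move=> /addSP[z [_ [zZ /imSP[w wZ ->] vE]]]; apply/cls_eq0; first exact: DZ.
apply/addSP; exists 0, (D z); split; first exact: rpred0.
  apply/imSP; exists z => //; move: zZ; rewrite !fZP => /andP[zF DzF].
  by apply/andP; split; [apply: fil_le zF|apply: fil_le DzF]; lia.
by rewrite vE linearD DD addr0 add0r.
Qed.

Definition page_diff s i j := sval (cls_diff s i j).
Lemma page_diffE s i j v : v \in fZ s i j ->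
  page_diff s i j (cls _ _ v) = cls _ _ (D v).
Proof. exact: (svalP (cls_diff s i j)). Qed.

Lemma page_diff_diff s i j x : page_diff s (i + 1) (j + s) (page_diff s i j x) = 0.
Proof.
have [v vZ ->] := cls_surj x; rewrite !page_diffE //.
  by rewrite DD cls0.
by move: vZ; rewrite !fZP DD rpred0 andbT => /andP[].
Qed.

(** For a filtration in steps of 1, homology of page s is page s + 1. Projecting representatives
    onto one residue class reaches s + n at once. The natural map from [fpage s'] to the homology is
    shown to be bijective, and [t] is its inverse. *)
Lemma cls_turn (s s' : int) i j : 0 <= s -> (n%:Z %| s)%Z -> s' = s + n%:Z ->
  {t : {linear homology (page_diff s i j) (page_diff s (i + 1) (j + s))
        -> fpage s' (i + 1) (j + s)} | bijective t /\
    forall v, v \in fZ s' (i + 1) (j + s) -> t (cls _ _ (cls _ _ v)) = cls _ _ v}.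
Proof.
move=> s_ge0 dvd_s s'E.
have ZZ v : v \in fZ s' (i + 1) (j + s) -> v \in fZ s (i + 1) (j + s).
  by rewrite !fZP => /andP[-> DvF]; apply: fil_le DvF; lia.
have Zker v : v \in fZ s' (i + 1) (j + s) ->
    cls (fZ s (i + 1) (j + s)) (fB s (i + 1) (j + s)) v
      \in kerS (page_diff s (i + 1) (j + s)).
  move=> vZ; apply/kerSP; rewrite page_diffE ?ZZ //; apply/cls_eq0.
    by move: vZ; rewrite !fZP DD rpred0 andbT => /andP[_ DvF]; apply: fil_le DvF; lia.
  apply/addSP; exists (D v), 0; split; rewrite ?rpred0 ?addr0 //.
  move: vZ; rewrite !fZP DD rpred0 andbT => /andP[_ DvF]; apply: fil_le DvF; lia.
have fL c u v : u \in fZ s' (i + 1) (j + s) -> v \in fZ s' (i + 1) (j + s) ->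
    cls (kerS (page_diff s (i + 1) (j + s))) (limS (page_diff s i j))
      (cls _ _ (c *: u + v)) = c *: cls _ _ (cls _ _ u) + cls _ _ (cls _ _ v).
  by move=> uZ vZ; rewrite clsP ?ZZ // clsP ?Zker.
have [|g gE] := subquot_map (B := fB s' (i + 1) (j + s)) fL.
  move=> v vZ /addSP[z [_ [zZ /imSP[u uZ ->] vE]]].
  apply/cls_eq0; [exact: Zker | apply/limSP].
  (* Here u has filtration degree j - n + 1 only; its projection onto the class of j has degree j,
     by [dvdz_jump]. The boundary of the rest u - u1 has degree above j + s and joins z in the
     denominator. *)
  pose u1 := restrict (residue j) u.
  have u1Z : u1 \in fZ s i j.
    move: uZ; rewrite !fZP D_residue => /andP[uF DuF]; apply/andP; split.
      apply: fil_le (_ : u1 \in fil (i + 1 - 1) j); [lia | by [] |].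
      apply: residue_fil uF => q dv_q le_q; apply: (dvdz_jump dv_q); lia.
    by apply: restrict_fil; apply: fil_le DuF; lia.
  exists (cls _ _ u1); rewrite page_diffE //; apply/cls_eq; first exact: ZZ.
    by move: u1Z; rewrite !fZP DD rpred0 andbT => /andP[].
  apply/addSP; exists (z + D (u - u1)), 0; split; rewrite ?rpred0 //.
    apply: rpredD; move: zZ uZ; rewrite !fZP.
      by move=> /andP[zF DzF] _; rewrite zF; apply: fil_le DzF; lia.
    move=> _ /andP[uF DuF]; rewrite DD rpred0 andbT linearB D_residue.
    rewrite -(restrict_residueD _ _ dvd_s); apply: residueC_fil; apply: fil_le DuF; lia.
  by rewrite addr0 vE linearB addrA.
have g_bij : bijective g.
  apply: (subquot_map_bij gE).
    move=> v vZ /(cls_eq0 _ (Zker _ vZ)) /limSP[x].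
    have [u uZ ->] := cls_surj x; rewrite page_diffE // => vDu.
    have DuZ : D u \in fZ s (i + 1) (j + s).
      by move: uZ; rewrite !fZP DD rpred0 andbT => /andP[].
    move/(cls_eq _ (ZZ _ vZ) DuZ): vDu => /addSP[z [_ [zZ /imSP[w wZ ->] vE]]].
    have {}vE : v = z + D (w + u) by rewrite -[LHS](subrK (D u)) vE linearD addrA.
    apply/addSP; exists z, (D (w + u)); split=> //.
      (* As D squares to zero, z has the same boundary as v, and so inherits its higher filtration
         degree. *)
      have zE : z = v - D (w + u) by rewrite vE addrK.
      have DzE : D z = D v by rewrite zE linearB DD subr0.
      move: zZ vZ; rewrite !fZP DzE => /andP[zF _] /andP[_ DvF].
      by apply/andP; split; [apply: fil_le zF|apply: fil_le DvF]; lia.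
    apply/imSP; exists (w + u) => //; rewrite fZP.
    move: uZ wZ {vE DuZ}; rewrite !fZP => /andP[uF DuF] /andP[wF DwF].
    rewrite linearD; apply/andP; split; apply: rpredD.
    - by apply: fil_le wF; lia.
    - by apply: fil_le uF; lia.
    - by apply: fil_le DwF; lia.
    - by apply: fil_le DuF; lia.
  move=> w; have [x /kerSP x0 ->] := cls_surj w.
  have [v vZ xE] := cls_surj x; move: x0; rewrite xE page_diffE // => Dv0.
  have DvZ : D v \in fZ s (i + 1 + 1) (j + s + s).
    by move: vZ; rewrite !fZP DD rpred0 andbT => /andP[].
  (* A cycle of page s: after subtraction of u, of filtration degree j + s + 1, the boundary of v
     becomes z, of degree at least j + s + s + 1. *)
  move/(cls_eq0 _ DvZ): Dv0 => /addSP[z [_ [zZ /imSP[u uZ ->] DvE]]].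
  have v1E : D (v - u) = z by rewrite linearB DvE addrK.
  have v1F : v - u \in fil (i + 1) (j + s).
    move: vZ uZ; rewrite !fZP => /andP[vF _] /andP[uF _]; apply: submodB => //.
    by apply: fil_le uF; lia.
  (* This projection raises the filtration degree of the boundary from
     j + s + s + 1 to j + s + s'. *)
  pose v2 := restrict (residue (j + s)) (v - u).
  have v2Z : v2 \in fZ s' (i + 1) (j + s).
    rewrite fZP restrict_fil //= D_residue v1E.
    rewrite -(restrict_residueD _ (s := s')); last by rewrite s'E rpredD ?dvdzz.
    move: zZ; rewrite fZP => /andP[zF _].
    apply: residue_fil zF => q dv_q le_q; apply: (dvdz_jump dv_q); lia.
  (* The discarded components have filtration degree above j + s, so v2 represents the same class as
     v on page s. *)
  have v12 : v - v2 \in fB s (i + 1) (j + s).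
    apply/addSP; exists (v - v2), 0; split; rewrite ?rpred0 ?addr0 //.
    rewrite fZP; apply/andP; split.
      rewrite -[v in v - v2](subrK u) addrAC; apply: rpredD.
        exact: residueC_fil.
      by move: uZ; rewrite !fZP => /andP[uF _]; apply: fil_le uF; lia.
    rewrite linearB; apply: submodB.
      move: vZ; rewrite fZP => /andP[_ DvF]; apply: fil_le DvF; lia.
    move: v2Z; rewrite fZP => /andP[_ DvF]; apply: fil_le DvF; lia.
  exists v2 => //; congr cls; rewrite ?xE.
  by apply/esym/cls_eq => //; apply: ZZ.
have [t [t_bij gK]] := linear_inverse g_bij.
by exists t; split=> // v vZ; rewrite -gE // gK.
Qed.

Definition page_turn s s' i j s_ge0 dvd_s s'E :=
  sval (@cls_turn s s' i j s_ge0 dvd_s s'E).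

Fact dvdz_page r : (n%:Z %| (r * n)%N%:Z)%Z.
Proof. by rewrite PoszM dvdz_mull. Qed.
Fact page_succ r : (r.+1 * n)%N%:Z = (r * n)%N%:Z + n%:Z.
Proof. by rewrite mulSn addnC PoszD. Qed.

Definition filtered_sseq : spectralSequence k n :=
  @SpectralSequence k n (fun r => fpage (r * n)%N%:Z)
    (fun r => page_diff (r * n)%N%:Z) (fun r => @page_diff_diff (r * n)%N%:Z)
    (fun r i j => @page_turn (r * n)%N%:Z (r.+1 * n)%N%:Z i j
                    (le0z_nat _) (dvdz_page r) (page_succ r))
    (fun r i j => (svalP (@cls_turn (r * n)%N%:Z (r.+1 * n)%N%:Z i j
                    (le0z_nat _) (dvdz_page r) (page_succ r))).1).

Lemma filtered_sseq_attached : attached hdeg qdeg D filtered_sseq.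
Proof.
exists (fun r i j => idfun : {linear page filtered_sseq r i j -> fpage _ i j}).
split=> [r i j|r i j x v vZ /= ->|r i j x v vZ /= ->].
- by exists idfun.
- exact: page_diffE.
- exact: (svalP (@cls_turn (r * n)%N%:Z (r.+1 * n)%N%:Z i j
                    (le0z_nat _) (dvdz_page r) (page_succ r))).2.
Qed.

(** * The first page *)

Definition qpart j : pred X := fun x => qdeg x == j.

Lemma bipartP i j v :
  reflect (forall x, v x != 0 -> hdeg x = i /\ qdeg x = j)
    (v \in bipart k hdeg qdeg i j).
Proof.
apply: (iffP (submod_ofP _ _ _)) => vP x /vP; first by move=> /andP[/eqP ? /eqP].
by move=> [hx qx]; rewrite /= hx qx !eqxx.
Qed.

Lemma hpartP i v :
  reflect (forall x, v x != 0 -> hdeg x = i) (v \in hpart k hdeg i).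
Proof.
by apply: (iffP (submod_ofP _ _ _)) => vP x /vP; [move/eqP | move=> /= ->].
Qed.

Lemma bipart_fil i j v : v \in bipart k hdeg qdeg i j -> v \in fil i j.
Proof. by move=> /bipartP vP; apply/filP => x /vP[-> ->]. Qed.

Lemma restrict_bipart i j j' v :
  v \in fil i j' -> restrict (qpart j) v \in bipart k hdeg qdeg i j.
Proof.
move=> /filP vF; apply/bipartP => x; rewrite restrictE.
by case: ifP; rewrite ?eqxx // => /eqP-> /vF[].
Qed.

Lemma restrict_bipart_id i j v :
  v \in bipart k hdeg qdeg i j -> restrict (qpart j) v = v.
Proof.
move=> /bipartP vP; apply/ffunP => x; rewrite restrictE /qpart.
case: eqP => // qx; apply/eqP; rewrite eq_sym; apply/negPn/negP => /vP[_].
exact: qx.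
Qed.

Lemma restrict_fil0 i j j' v : j < j' -> v \in fil i j' -> restrict (qpart j) v = 0.
Proof.
move=> lt_j /filP vF; apply/ffunP => x; rewrite !ffunE /qpart.
case: eqP => // qx; apply/eqP/negPn/negP => /vF[_].
by rewrite qx leNgt lt_j.
Qed.

Lemma restrictC_fil i j v : v \in fil i j -> v - restrict (qpart j) v \in fil i (j + 1).
Proof.
move=> /filP vF; apply/filP => x; rewrite !ffunE /qpart; case: (eqVneq (qdeg x) j) => [_|qx].
  by rewrite subrr eqxx.
by rewrite subr0 => /vF[-> le_j]; split=> //; lia.
Qed.

(** The part of D of degree n could reach degree j only from degree j - n, where [v] has no
    component. *)
Lemma D_qpart i j j' v : v \in fil i j' -> j - n%:Z < j' ->
  restrict (qpart j) (D v) = N (restrict (qpart j) v).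
Proof.
move=> /filP vF lt_j; apply/ffunP => y; rewrite restrictE !matrix_mapE.
have -> : (if qpart j y then \sum_x a x y * v x else 0)
  = \sum_x (if qpart j y then a x y * v x else 0).
  by case: (qpart j y); rewrite // big1.
apply: eq_bigr => x _; rewrite restrictE bE /qpart.
have [-> | vx] := eqVneq (v x) 0; first by rewrite if_same !mulr0 if_same.
have [_ le_j'] := vF x vx.
have [-> | axy] := eqVneq (a x y) 0; first by rewrite if_same !mul0r if_same.
have [_ dq] := a_deg axy; case: (eqVneq (qdeg x) j) => [<-|qx] /=.
  by case: (qdeg y == qdeg x); rewrite ?mul0r.
rewrite mulr0; case: eqP => // qy; case: dq => dq; move/eqP: qx; lia.
Qed.

Lemma DN_fil i j v : v \in fil i j -> D v - N v \in fil (i + 1) (j + n%:Z).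
Proof.
move=> /filP vF; apply/filP => y; rewrite !ffunE -sumrB => /eqP sum_neq0.
have [x] : exists x, a x y * v x - b x y * v x != 0.
  apply/existsP; apply: contraT => /existsPn all0; case: sum_neq0.
  by apply: big1 => x _; apply/eqP/negPn/all0.
rewrite bE -mulrBl; have [-> | axy] := eqVneq (a x y) 0.
  by rewrite if_same subrr mul0r eqxx.
have [-> dq] := a_deg axy; case: (eqVneq (qdeg y) (qdeg x)) => [_|qy ne0].
  by rewrite subrr mul0r eqxx.
have [|-> le_j] := vF x; first by apply: contraNneq ne0 => ->; rewrite mulr0.
by split=> //; case: dq => dq; lia.
Qed.

(** A homogeneous N-cycle v satisfies D v = D v - N v, of filtration degree j + n, hence lies in
    [fZ n]. Conversely, the degree j part of an element of [fZ n] is an N-cycle, by [D_qpart], and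
    represents the same class. *)
Lemma fpage_bihomology i j : lmod_iso (fpage n i j) (bihomology hdeg qdeg N i j).
Proof.
have bZ v : v \in capS (bipart k hdeg qdeg i j) (kerS N) -> v \in fZ n i j.
  rewrite mem_capS => /andP[/bipart_fil vF /kerSP Nv0]; rewrite fZP vF /=.
  by have := DN_fil vF; rewrite Nv0 subr0.
have fL c u v : u \in capS (bipart k hdeg qdeg i j) (kerS N) ->
    v \in capS (bipart k hdeg qdeg i j) (kerS N) ->
    cls (fZ n i j) (fB n i j) (c *: u + v) = c *: cls _ _ u + cls _ _ v.
  by move=> /bZ uZ /bZ vZ; rewrite clsP.
have [|g gE] := subquot_map (B := imS N (bipart k hdeg qdeg (i - 1) j)) fL.
  move=> v vZ /imSP[u uP vE]; apply/cls_eq0; first exact: bZ.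
  have uF := bipart_fil uP; have tF := DN_fil uF.
  (* An N-boundary differs from a D-boundary by a term of filtration degree j + n, which belongs to
     the other summand of the denominator. *)
  apply/addSP; exists (N u - D u), (D u); split; last by rewrite subrK.
    rewrite fZP -[N u - D u]opprB linearN !submodN linearB DD sub0r submodN.
    apply/andP; split; first by apply: fil_le tF; lia.
    rewrite -submodN -[- D _]sub0r -(DD u) -linearB.
    by apply: fil_le (D_fil erefl tF); lia.
  apply/imSP; exists u => //; rewrite fZP.
  by apply/andP; split; [apply: fil_le uF|apply: fil_le (D_fil erefl uF)]; lia.
have g_bij : bijective g.
  apply: (subquot_map_bij gE).
    move=> v vZ /(cls_eq0 _ (bZ _ vZ)) /addSP[z [_ [zZ /imSP[u uZ ->] vE]]].
    move: vZ zZ uZ; rewrite mem_capS !fZP.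
    move=> /andP[vP _] /andP[zF _] /andP[uF _].
    apply/imSP; exists (restrict (qpart j) u); first exact: restrict_bipart uF.
    rewrite -(D_qpart uF); last by lia.
    rewrite -(restrict_bipart_id vP) vE.
    have -> : z + D u = D u - - z by rewrite opprK addrC.
    rewrite restrictB.
    by rewrite (@restrict_fil0 i j (j + 1) (- z)) ?submodN ?subr0 //; lia.
  move=> w; have [v vZ ->] := cls_surj w; exists (restrict (qpart j) v).
    move: vZ; rewrite fZP mem_capS => /andP[vF DvF].
    rewrite (restrict_bipart _ vF) /=; apply/kerSP; rewrite -(D_qpart vF); last by lia.
    by apply: restrict_fil0 DvF; lia.
  have vbZ : restrict (qpart j) v \in capS (bipart k hdeg qdeg i j) (kerS N).
    move: vZ; rewrite fZP mem_capS => /andP[vF DvF].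
    rewrite (restrict_bipart _ vF) /=; apply/kerSP; rewrite -(D_qpart vF); last by lia.
    by apply: restrict_fil0 DvF; lia.
  apply/esym/cls_eq; [by [] | exact: bZ | apply/addSP].
  exists (v - restrict (qpart j) v), 0; split; rewrite ?rpred0 ?addr0 //.
  move: vZ (bZ _ vbZ); rewrite !fZP => /andP[vF DvF] /andP[_ DbF].
  rewrite restrictC_fil // andTb linearB; apply: submodB.
    by apply: fil_le DvF; lia.
  by apply: fil_le DbF; lia.
have [t [t_bij _]] := linear_inverse g_bij.
by exists t.
Qed.

(** * Degeneration of a bounded filtration *)

Section Degeneration.
Variable B : nat.
Hypothesis q_bound : forall x, (`|qdeg x| <= B)%N.
Variable s : int.
Hypothesis s_large : (2 * B)%N%:Z < s.

Lemma fil_hpart i j v : j <= - B%:Z -> (v \in fil i j) = (v \in hpart k hdeg i).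
Proof.
move=> le_j; apply/filP/hpartP => vP x /vP; first by case.
by split=> //; have := q_bound x; lia.
Qed.

Lemma fil_eq0 i j v : B%:Z < j -> v \in fil i j -> v = 0.
Proof.
move=> lt_j /filP vF; apply/ffunP => x; rewrite ffunE; apply/eqP/negPn/negP.
by move=> /vF[_]; have := q_bound x; lia.
Qed.

(** Below all quantum degrees the filtration steps j and j + 1 coincide, so the whole numerator lies
    in the denominator. *)
Lemma fpage_eq0 i j (x : fpage s i j) : j < - B%:Z -> x = 0.
Proof.
move=> lt_j; have [v vZ ->] := cls_surj x; apply/cls_eq0 => //.
apply/addSP; exists v, 0; split; rewrite ?rpred0 ?addr0 //.
move: vZ; rewrite !fZP => /andP[vF DvF]; apply/andP; split.
  by rewrite fil_hpart -?(@fil_hpart _ j) //; lia.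
by apply: fil_le DvF; lia.
Qed.

(** Here j + s exceeds B, and the boundary lies above every quantum degree. *)
Lemma fZ_ker i j v : - B%:Z <= j -> v \in fZ s i j -> D v = 0.
Proof. by move=> le_j; rewrite fZP => /andP[_]; apply: fil_eq0; lia. Qed.

Lemma page_diff_eq0 i j x : page_diff s i j x = 0.
Proof.
have [lt_j|le_j] := ltrP j (- B%:Z); first by rewrite (fpage_eq0 x lt_j) linear0.
have [v vZ ->] := cls_surj x; rewrite page_diffE //.
by rewrite (fZ_ker le_j vZ) cls0.
Qed.

Lemma grH_eq0 i j (x : grH hdeg qdeg D i j) : j < - B%:Z -> x = 0.
Proof.
move=> lt_j; have [y yF ->] := cls_surj x; apply/cls_eq0 => //.
move/submod_ofP: yF => [v vF ->]; apply/submod_ofP; exists v => //.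
by move: vF; rewrite !mem_capS !fil_hpart //; lia.
Qed.

Lemma fpage_grH i j : lmod_iso (fpage s i j) (grH hdeg qdeg D i j).
Proof.
have [lt_j|le_j] := ltrP j (- B%:Z).
  pose z (x : fpage s i j) : grH hdeg qdeg D i j := 0.
  have zL : linear z by move=> c x y; rewrite /z scaler0 addr0.
  pose L := GRing.isLinear.Build k _ _ *:%R z zL.
  exists (HB.pack z L : {linear fpage s i j -> grH hdeg qdeg D i j}).
  exists (fun=> 0) => x; first by rewrite [RHS]fpage_eq0.
  by rewrite [RHS]grH_eq0.
pose Z := capS (hpart k hdeg i) (kerS D).
pose I := imS D (hpart k hdeg (i - 1)).
have ZK v : v \in fZ s i j -> v \in capS (fil i j) (kerS D).
  move=> vZ; rewrite mem_capS; apply/andP; split; last exact/kerSP/(fZ_ker le_j vZ).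
  by move: vZ; rewrite fZP => /andP[].
have ZZ v : v \in fZ s i j -> v \in Z by move=> /ZK/fil_sub.
have ZF v : v \in fZ s i j -> cls Z I v \in filH hdeg qdeg D i j.
  by move=> /ZK vK; apply/submod_ofP; exists v.
have fL c u v : u \in fZ s i j -> v \in fZ s i j ->
    cls (filH hdeg qdeg D i j) (filH hdeg qdeg D i (j + 1)) (cls Z I (c *: u + v))
    = c *: cls _ _ (cls Z I u) + cls _ _ (cls Z I v).
  by move=> uZ vZ; rewrite clsP ?ZZ // clsP ?ZF.
have [|g gE] := subquot_map (B := fB s i j) fL.
  move=> v vZ /addSP[z [_ [zZ /imSP[u uZ ->] vE]]].
  have Dz0 : D z = 0.
    by move: zZ; rewrite fZP => /andP[_]; apply: fil_eq0; lia.
  have zK : z \in capS (fil i (j + 1)) (kerS D).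
    rewrite mem_capS; move: zZ; rewrite fZP => /andP[-> _].
    by rewrite andTb; exact/kerSP.
  apply/cls_eq0; [exact: ZF | apply/submod_ofP; exists z => //].
  apply/cls_eq; [exact: ZZ | exact: fil_sub zK |].
  apply/imSP; exists u; last by rewrite vE addrC addKr.
  by move: uZ; rewrite fZP => /andP[/filP uF _]; apply/hpartP => x /uF[].
exists g; apply: (subquot_map_bij gE).
  (* Above B there are no chains. For j at most B the degree j - s + 1 is at most -B, so the
     filtration puts no condition on the chain u bounding the difference. *)
  move=> v vZ; have [lt_j|le_jB] := ltrP B%:Z j.
    by move: vZ; rewrite fZP => /andP[/(fil_eq0 lt_j)->]; rewrite rpred0.
  move=> /(cls_eq0 _ (ZF _ vZ)) /submod_ofP[v' v'K].
  move=> /(cls_eq _ (ZZ _ vZ) (fil_sub v'K)) /imSP[u uP vE].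
  move: v'K; rewrite mem_capS => /andP[v'F /kerSP Dv'].
  apply/addSP; exists v', (D u); split; last by rewrite -vE addrC subrK.
    by rewrite fZP v'F Dv' rpred0.
  apply/imSP; exists u => //; rewrite fZP fil_hpart; last by lia.
  rewrite uP andTb -vE; apply: submodB; last by apply: fil_le v'F; lia.
  by move: vZ; rewrite fZP => /andP[vF _]; apply: fil_le vF; lia.
move=> w; have [y yF ->] := cls_surj w; move/submod_ofP: (yF) => [v vK yE].
exists v; last by rewrite yE.
by move: vK; rewrite mem_capS fZP => /andP[-> /kerSP->]; rewrite rpred0.
Qed.
End Degeneration.

Lemma filtered_sseq_Einfty : Einfty_iso filtered_sseq (grH hdeg qdeg D).
Proof.
pose B := (\max_x `|qdeg x|)%N.
have q_bound x : (`|qdeg x| <= B)%N by apply: (leq_bigmax x).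
have large r : (2 * B < r)%N -> (2 * B)%N%:Z < (r * n)%N%:Z.
  by move=> lt_r; rewrite ltz_nat; apply: leq_trans lt_r (leq_pmulr _ n_gt0).
(* Since n is positive, r > 2 B gives r n > 2 B, the bound used above. *)
exists (2 * B).+1; split=> [r i j x /large lt_r|i j].
  exact: page_diff_eq0 q_bound _ lt_r _ _ x.
exact: fpage_grH q_bound _ (large _ _) _ _.
Qed.

Lemma filtered_sseq_E1 i j :
  lmod_iso (page filtered_sseq 1 i j) (bihomology hdeg qdeg N i j).
Proof. by have := fpage_bihomology i j; rewrite -{1}(mul1n n). Qed.
End FilteredComplex.

(** * Circles of a state *)

Lemma involution_even (T : finType) (f : T -> T) (A : {set T}) :
  {in A, forall x, f x \in A} -> {in A, involutive f} ->
  {in A, forall x, f x != x} -> ~~ odd #|A|.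
Proof.
have [m] := ubnP #|A|; elim: m A => // m IHm A lt_A fA fK fN.
have [->|[x xA]] := set_0Vmem A; first by rewrite cards0.
have fxA : f x \in A :\ x by rewrite !inE fN ?fA.
rewrite (cardsD1 x) xA (cardsD1 (f x)) fxA addnA oddD /= IHm //.
- by move: lt_A; rewrite (cardsD1 x) xA (cardsD1 (f x)) fxA; lia.
- move=> y; rewrite !inE => /and3P[yfx yx yA]; rewrite fA // andbT.
  by rewrite (can_in_eq fK) // yx /= -[x in _ != x]fK // (can_in_eq fK) ?fA.
- by move=> y; rewrite !inE => /and3P[_ _ yA]; apply: fK.
- by move=> y; rewrite !inE => /and3P[_ _ yA]; apply: fN.
Qed.

Lemma connect_ind (T : finType) (e : rel T) (P : T -> Prop) x y :
  P x -> (forall u v, P u -> e u v -> P v) -> connect e x y -> P y.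
Proof.
move=> Px Pe /connectP[s path_s ->]; elim: s x Px path_s => //= z s IHs x Px.
by move=> /andP[/Pe-/(_ Px)]; apply: IHs.
Qed.

Section States.
Variables (G : ribbonGraph) (l : nat) (M : l.-tuple {set dart G}).
Hypothesis triv : trivalent G.
Hypothesis pm : perfect_matching M.
Implicit Types (x y h u v : dart G) (p q : 'I_l) (al be : resolution l).

Notation r := (rotation G).
Notation U := (fun x => ~~ matched M x).

Lemma vertexE x : vertex x = [set x; r x; r (r x)].
Proof.
apply/setP => y; rewrite /vertex porbit_traject -/(vertex x) triv /=.
by rewrite !inE orbA.
Qed.

Lemma rotation_order x : r (r (r x)) = x.
Proof. by have := iter_porbit r x; rewrite -/(vertex x) triv. Qed.

Lemma rotVE x : rotV x = r (r x).
Proof. by rewrite /rotV -{1}[x]rotation_order permK. Qed.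

Lemma rotation_neq x : uniq [:: x; r x; r (r x)].
Proof. by have := uniq_traject_porbit r x; rewrite -/(vertex x) triv. Qed.

Lemma matched_vertex x :
  (matched M x + matched M (r x) + matched M (r (r x)) = 1)%N.
Proof.
case: pm => _ _ /(_ x) <-; set s := [:: x; r x; r (r x)].
transitivity (size (filter (matched M) s)).
  by rewrite size_filter /= addn0 addnA.
rewrite -(card_uniqP (filter_uniq _ (rotation_neq x))); apply: eq_card => y.
by rewrite mem_filter vertexE !inE orbA andbC.
Qed.

Lemma tnth_edge p h : h \in tnth M p -> tnth M p = [set h; mate h].
Proof.
case: pm => _ /(_ _ (mem_tnth p M)) /imsetP[x _ ->] _.
by rewrite !inE => /orP[]/eqP-> //; rewrite mateK setUC.
Qed.

Lemma mate_tnth p h : h \in tnth M p -> mate h \in tnth M p.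
Proof. by move=> /tnth_edge->; rewrite !inE eqxx orbT. Qed.

Lemma tnth_matched p h : h \in tnth M p -> matched M h.
Proof. by move=> hp; apply/existsP; exists p. Qed.

Lemma tnth_inj_mem p q h : h \in tnth M p -> h \in tnth M q -> p = q.
Proof.
move=> /tnth_edge hp /tnth_edge hq; case: pm => uM _ _.
by apply/(tuple_uniqP _ uM); rewrite hp hq.
Qed.

Lemma mate_matched x : matched M (mate x) = matched M x.
Proof.
by apply/existsP/existsP => -[p /mate_tnth]; rewrite ?mateK => ?; exists p.
Qed.

Lemma tnth_dart p : exists h, h \in tnth M p.
Proof.
case: pm => _ /(_ _ (mem_tnth p M)) /imsetP[x _ ->] _; exists x.
by rewrite !inE eqxx.
Qed.

Lemma rotation_unmatched h : matched M h -> U (r h).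
Proof. by have := matched_vertex h => /[swap] ->; case: (matched M (r h)). Qed.

Lemma rotV_unmatched h : matched M h -> U (rotV h).
Proof.
rewrite rotVE; have := matched_vertex h => /[swap] ->.
by case: (matched M (r (r h))); case: (matched M (r h)).
Qed.

Lemma rotation_rotV h : r (rotV h) = h.
Proof. by rewrite rotVE rotation_order. Qed.

Lemma rotation_rotV_neq h : r h != rotV h.
Proof.
by have := rotation_neq h; rewrite /= rotVE !inE => /and3P[]/norP[].
Qed.

Lemma mdart_rotation h : matched M h -> mdart M (r h) = h.
Proof.
move=> hM; rewrite /mdart -rotVE (negPf (rotV_unmatched hM)).
by rewrite /rotV permK.
Qed.

Lemma mdart_rotV h : matched M h -> mdart M (rotV h) = h.
Proof. by move=> hM; rewrite /mdart rotation_rotV hM. Qed.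

Lemma unmatchedP x : U x ->
  matched M (mdart M x) /\ (x = r (mdart M x) \/ x = rotV (mdart M x)).
Proof.
move=> /negPf xU; rewrite /mdart; case: ifP => rxM.
  by split=> //; right; rewrite /rotV permK.
split; last by left; rewrite rotation_rotV.
by have := matched_vertex x; rewrite xU rxM rotVE; case: matched.
Qed.

Definition smoothed al h := [exists p, (h \in tnth M p) && al p].

Lemma smoothedE al p h : h \in tnth M p -> smoothed al h = al p.
Proof.
move=> hp; apply/existsP/idP => [[q /andP[hq]]|alp].
  by rewrite (tnth_inj_mem hp hq).
by exists p; rewrite hp.
Qed.

(** For a matched h these are the two unmatched half-edges at its vertex, and every unmatched
    half-edge is of this form. In these coordinates position, twist and smoothing enter [smooth]
    only through a parity. *)
Definition side (b : bool) h := if b then r h else rotV h.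

Lemma side_unmatched b h : matched M h -> U (side b h).
Proof. by case: b; [apply: rotation_unmatched | apply: rotV_unmatched]. Qed.

Lemma mdart_side b h : matched M h -> mdart M (side b h) = h.
Proof. by case: b; [apply: mdart_rotation | apply: mdart_rotV]. Qed.

Lemma sideP x : U x -> exists b h p, x = side b h /\ h \in tnth M p.
Proof.
move=> /unmatchedP[/existsP[p hp] xE].
by case: xE => xE; [exists true | exists false]; exists (mdart M x), p.
Qed.

Lemma side_eq b c h : (side b h == side c h) = (b == c).
Proof.
by case: b c => -[]; rewrite /= ?eqxx //; [|rewrite eq_sym];
  apply/negbTE/rotation_rotV_neq.
Qed.

Lemma smooth_side al p b h : h \in tnth M p ->
  smooth M al (side b h) = side (~~ (b (+) twist h (+) al p)) (mate h).
Proof.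
move=> hp; have hM := tnth_matched hp.
rewrite /smooth mdart_side // -/(smoothed al h) (smoothedE al hp).
have -> : (side b h == r h) = b by rewrite (side_eq b true h); case: b.
by case: (_ (+) _).
Qed.

Lemma smooth_unmatched al x : U x -> U (smooth M al x).
Proof.
move=> /sideP[b [h [p [-> hp]]]]; rewrite (smooth_side _ _ hp).
exact/side_unmatched/(tnth_matched (mate_tnth hp)).
Qed.

Lemma smoothK al x : U x -> smooth M al (smooth M al x) = x.
Proof.
move=> /sideP[b [h [p [-> hp]]]].
rewrite !(smooth_side _ _ hp, smooth_side _ _ (mate_tnth hp)).
by rewrite mateK twist_mate; case: b (twist h) (al p) => -[] [].
Qed.

Lemma smooth_neq al x : U x -> smooth M al x != x.
Proof.
move=> /sideP[b [h [p [-> hp]]]]; rewrite (smooth_side _ _ hp).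
apply: contra (mate_neq h) => /eqP/(congr1 (mdart M)) /eqP.
by rewrite !mdart_side ?(tnth_matched hp) ?(tnth_matched (mate_tnth hp)).
Qed.

Definition adjacent al : rel (dart G) :=
  [rel u v | (v == mate u) || (v == smooth M al u)].

Lemma adjacent_unmatched al u v : U u -> adjacent al u v -> U v.
Proof.
by move=> uU /orP[]/eqP->; rewrite ?smooth_unmatched // mate_matched.
Qed.

Lemma adjacent_sym al u v : U u -> adjacent al u v -> adjacent al v u.
Proof.
by move=> uU /orP[]/eqP->; apply/orP; [left | right]; rewrite ?mateK ?smoothK.
Qed.

Lemma connect_unmatched al u v : U u -> connect (adjacent al) u v -> U v.
Proof.
move=> uU uv; apply: (connect_ind (P := fun w => U w) _ _ uv) => // x y.
exact: adjacent_unmatched.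
Qed.

(** Smoothing is an involution on unmatched half-edges only, so symmetry of the adjacency is claimed
    for these alone. *)
Lemma connect_sym_unmatched al u v :
  U u -> connect (adjacent al) u v -> connect (adjacent al) v u.
Proof.
move=> uU uv; suff [] : U v /\ connect (adjacent al) v u by [].
apply: (connect_ind (P := fun v => U v /\ connect (adjacent al) v u) _ _ uv).
  by [].
move=> x y [xU xu] xy; split.
  exact: adjacent_unmatched xy.
exact: connect_trans (connect1 (adjacent_sym xU xy)) xu.
Qed.

Definition circle_of al x : {set dart G} := [set y | connect (adjacent al) x y].

Lemma mem_circle_of al x : x \in circle_of al x.
Proof. by rewrite inE connect0. Qed.

Lemma circle_of_eq al x y : U x -> y \in circle_of al x ->
  circle_of al y = circle_of al x.
Proof.
move=> xU; rewrite inE => xy; apply/setP => z; rewrite !inE.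
apply/idP/idP; first exact: connect_trans.
exact/connect_trans/connect_sym_unmatched.
Qed.

Lemma circlesP al c :
  reflect (exists2 x, U x & c = circle_of al x) (c \in circles M al).
Proof.
by apply: (iffP imsetP) => -[x xU ->]; exists x => //; move: xU; rewrite inE.
Qed.

Lemma circle_of_mem al x : U x -> circle_of al x \in circles M al.
Proof. by move=> xU; apply/circlesP; exists x. Qed.

Lemma mem_circle al c x : c \in circles M al -> x \in c -> U x /\ c = circle_of al x.
Proof.
move=> /circlesP[y yU ->] xc; split; last by rewrite (circle_of_eq yU).
by move: xc; rewrite inE; apply: connect_unmatched.
Qed.

Lemma circle_eq al c d x : c \in circles M al -> d \in circles M al ->
  x \in c -> x \in d -> c = d.
Proof. by move=> cC dC /(mem_circle cC)[_ ->] /(mem_circle dC)[_ ->]. Qed.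

Lemma circle_neq0 al c : c \in circles M al -> exists x, x \in c.
Proof. by move=> /circlesP[x _ ->]; exists x; apply: mem_circle_of. Qed.

Lemma mate_circle al c x : c \in circles M al -> x \in c -> mate x \in c.
Proof.
move=> cC /(mem_circle cC)[_ ->]; rewrite inE; apply: connect1.
by rewrite /adjacent /= eqxx.
Qed.

Lemma smooth_circle al c x : c \in circles M al -> x \in c -> smooth M al x \in c.
Proof.
move=> cC /(mem_circle cC)[_ ->]; rewrite inE; apply: connect1.
by rewrite /adjacent /= eqxx orbT.
Qed.

Lemma affectedP p (c : {set dart G}) :
  reflect (exists b h, h \in tnth M p /\ side b h \in c) (affected M p c).
Proof.
apply: (iffP existsP) => [[h /andP[hp /orP[]hc]]|[[] [h [hp hc]]]].
- by exists true, h.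
- by exists false, h.
- by exists h; rewrite hp hc.
- by exists h; rewrite hp hc orbT.
Qed.

(** Half-edges at the other end of the p-th edge are joined by the smoothing to those at h, so by
    [affected_circlesP] one end suffices to list these circles. *)
Definition affected_circles p al := [set c in circles M al | affected M p c].

Lemma affected_circlesP p al h : h \in tnth M p ->
  affected_circles p al = [set circle_of al (r h); circle_of al (rotV h)].
Proof.
move=> hp; have hM := tnth_matched hp.
have rU b := side_unmatched b hM.
apply/setP => c; rewrite !inE; apply/andP/orP => [[cC /affectedP[b [h' [h'p h'c]]]]|].
  suff [b' b'c] : exists b', side b' h \in c.
    have [_ ->] := mem_circle cC b'c.
    by case: b' {b'c}; [left | right].
  have := h'p; rewrite (tnth_edge hp) !inE => /orP[]/eqP h'E.
    by exists b; rewrite -h'E.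
  exists (~~ (b (+) twist h' (+) al p)); have -> : h = mate h' by rewrite h'E mateK.
  by rewrite -(smooth_side _ _ h'p) (smooth_circle cC).
case=> /eqP->; split; try exact/circle_of_mem/(rU true).
- by apply/affectedP; exists true, h; rewrite mem_circle_of.
- exact/circle_of_mem/(rU false).
- by apply/affectedP; exists false, h; rewrite mem_circle_of.
Qed.

(** * The effect on circles of changing one smoothing *)

Section Flip.
Variables (p : 'I_l) (al be : resolution l).
Hypothesis al_be : al p != be p.
Hypothesis al_be_eq : forall q, q != p -> al q = be q.

Lemma smooth_far (c : {set dart G}) x : U x -> x \in c -> ~~ affected M p c ->
  smooth M be x = smooth M al x.
Proof.
move=> /sideP[b [h [q [-> hq]]]] xc.
have [qp /affectedP[]| qp _] := eqVneq q p; first by exists b, h; rewrite -qp.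
by rewrite !(smooth_side _ _ hq) al_be_eq.
Qed.

(** The two smoothings agree at every half-edge of c, so a path of either state starting on c stays
    on c and is a path of the other state. *)
Lemma unaffected_circle c :
  c \in circles M al -> ~~ affected M p c -> c \in circles M be.
Proof.
move=> cC c_far; have [x xc] := circle_neq0 cC; have [xU cE] := mem_circle cC xc.
apply/circlesP; exists x => //; apply/setP => y; apply/idP/idP.
  rewrite {1}cE !inE => xy.
  suff [] : connect (adjacent be) x y /\ y \in c by [].
  apply: (connect_ind (P := fun y => connect (adjacent be) x y /\ y \in c) _ _ xy).
    by [].
  move=> u v [xu uc] uv.
  have [uU _] := mem_circle cC uc.
  have vc : v \in c.
    by case/orP: uv => /eqP->; [apply: mate_circle cC _ | apply: smooth_circle cC _].
  split=> //; apply: connect_trans xu _; apply: connect1.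
  by rewrite /adjacent /= (smooth_far uU uc c_far).
rewrite inE => xy.
apply: (connect_ind (P := fun y => y \in c) _ _ xy) => // u v uc.
have [uU _] := mem_circle cC uc; rewrite /adjacent /= (smooth_far uU uc c_far).
by case/orP => /eqP->; [apply: mate_circle cC _ | apply: smooth_circle cC _].
Qed.

Lemma smooth_flip b h : h \in tnth M p ->
  smooth M be (side b h) = smooth M al (side (~~ b) h).
Proof.
move=> hp; rewrite !(smooth_side _ _ hp); move: al_be.
by case: b (al p) (be p) (twist h) => -[] [] [].
Qed.

(* If [x] were apart from the opposite half-edge in both states, then [mate]
   would be a fixed-point free involution of the set of half-edges lying on the
   circle of [x] in both states, and the smoothing one of this set minus [x];
   the two sets cannot both have even cardinality. *)
Lemma affected_card : #|affected_circles p al| = 2%N ->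
  #|affected_circles p be| = 1%N.
Proof.
have [h hp] := tnth_dart p; have hM := tnth_matched hp.
rewrite !(affected_circlesP _ hp) !cards2.
case: eqP => //= al_neq _; case: eqP => //= be_neq; exfalso.
pose x := r h; pose y := rotV h.
have xU : U x := side_unmatched true hM; have yU : U y := side_unmatched false hM.
pose A := circle_of al x :&: circle_of be x.
have AlC := circle_of_mem al xU; have BeC := circle_of_mem be xU.
have AU u : u \in A -> U u by rewrite inE => /andP[/(mem_circle AlC)[]].
have yNal : y \notin circle_of al x.
  by apply/negP => /(circle_of_eq xU) /esym.
have yNbe : y \notin circle_of be x.
  by apply/negP => /(circle_of_eq xU) /esym.
have flip_neq u : U u -> (exists b h', u = side b h' /\ h' \in tnth M p) ->
    smooth M al u != smooth M be u.
  move=> uU [b [h' [uE h'p]]]; rewrite uE (smooth_flip _ h'p).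
  apply/eqP => /(congr1 (smooth M al)).
  rewrite !smoothK ?side_unmatched ?(tnth_matched h'p) //.
  by move/eqP; rewrite side_eq; case: b {uE}.
have evenA : ~~ odd #|A|.
  apply: (@involution_even _ (@mate G)) => u; last by rewrite mate_neq.
    by rewrite !in_setI => /andP[ual ube]; rewrite (mate_circle AlC) // (mate_circle BeC).
  by rewrite mateK.
have smoothE u : u \in A :\ x -> smooth M be u = smooth M al u.
  rewrite in_setD1 => /andP[ux uA]; have [b [h' [q [uE h'q]]]] := sideP (AU u uA).
  have [qp|qp] := eqVneq q p; last by rewrite uE !(smooth_side _ _ h'q) al_be_eq.
  have /andP[ual ube] : (u \in circle_of al x) && (u \in circle_of be x).
    by rewrite -in_setI.
  rewrite qp in h'q; have := h'q; rewrite (tnth_edge hp) !inE => /orP[]/eqP h'E.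
    case: b uE => uE; first by rewrite uE h'E eqxx in ux.
    by rewrite uE h'E (negPf yNal) in ual.
  (* Now u sits at the far end of the p-th edge, so either smoothing sends it to x or y; y is on
     neither circle of x, and both smoothings give x. *)
  have onx ga : y \notin circle_of ga x -> smooth M ga u \in circle_of ga x ->
      smooth M ga u = x.
    rewrite uE (smooth_side _ _ h'q) h'E mateK.
    by case: (~~ (b (+) _ (+) _)) => //= /negPf->.
  by rewrite (onx be yNbe (smooth_circle BeC ube)) (onx al yNal (smooth_circle AlC ual)).
have xA : x \in A by rewrite in_setI !mem_circle_of.
have : ~~ odd #|A :\ x|.
  apply: (@involution_even _ (smooth M al)) => u uA.
  - have sE := smoothE u uA; move: (uA); rewrite in_setD1 => /andP[ux uA'].
    have uU := AU u uA'; move: uA'; rewrite in_setI => /andP[ual ube].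
    rewrite in_setD1 in_setI (smooth_circle AlC) // -{2}sE (smooth_circle BeC) //.
    rewrite !andbT; apply: contra_neqN (flip_neq x xU _); last by exists true, h.
    move=> /eqP sx; have sx' : smooth M be u = x by rewrite sE.
    by rewrite -{1}sx -sx' !smoothK.
  - by move: uA; rewrite in_setD1 => /andP[_ /AU uU]; rewrite smoothK.
  - by move: uA; rewrite in_setD1 => /andP[_ /AU uU]; rewrite smooth_neq.
by move: evenA; rewrite (cardsD1 x) xA /= => /negPn->.
Qed.
End Flip.
End States.

(** The common value of z on a circle where it is constant. The default 1 makes the n-th power equal
    to 1 for every set c. *)
Definition set_value (T : finType) (R : nzRingType) (z : T -> R) (c : {set T}) : R :=
  oapp z 1 [pick x in c].

Lemma set_valueE (T : finType) (R : nzRingType) (z : T -> R) (c : {set T}) x :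
  {in c &, forall u v, z u = z v} -> x \in c -> set_value z c = z x.
Proof.
move=> zc xc; rewrite /set_value; case: pickP => [y yc|/(_ x)]; last by rewrite xc.
exact: zc.
Qed.

(** Only the remainder of e modulo n contributes: evaluation at an n-th root of unity is well
    defined on k[x]/(x^n - 1). *)
Lemma sum_exp_eq (R : comNzRingType) n (z : R) e : (0 < n)%N -> z ^+ n = 1 ->
  \sum_(i < n) (exp_eq n true e i)%:R * z ^+ i = z ^+ e.
Proof.
move=> n_gt0 zn; rewrite (bigD1 (Ordinal (ltn_pmod e n_gt0))) //=.
rewrite modn_mod eqxx mul1r expr_mod // big1 ?addr0 // => i.
rewrite -val_eqE /= => /negPf neq; rewrite [(i %% n)%N]modn_small //.
by rewrite eq_sym neq mul0r.
Qed.

(** * Labelings and values on two neighbouring states *)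

Section States.
Variables (G : ribbonGraph) (l : nat) (M : l.-tuple {set dart G}).
Hypothesis triv : trivalent G.
Hypothesis pm : perfect_matching M.
Variables (n : nat) (n_gt0 : (0 < n)%N).
Implicit Types (x y h u v : dart G) (p q : 'I_l) (al be : resolution l).

Notation r := (rotation G).

(** Unlike [covers] this relation is symmetric, so that each lemma applies in both directions along
    an edge of the cube. *)
Definition flips p al be := al p != be p /\ forall q, q != p -> al q = be q.

Lemma flips_sym p al be : flips p al be -> flips p be al.
Proof. by case=> neq eq; split; [rewrite eq_sym | move=> q /eq]. Qed.

Definition agree p al be (f : labeling M n al) (g : labeling M n be) :=
  [forall c : circle M al, forall d : circle M be,
    (val c == val d) && ~~ affected M p (val c) ==> (f c == g d)].

Definition extend al be (f : labeling M n al) : labeling M n be :=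
  [ffun d => oapp f (Ordinal n_gt0) (insub (val d))].

Lemma naff_bounds p al : (0 < #|affected_circles M p al| <= 2)%N.
Proof.
have [h hp] := tnth_dart pm p.
by rewrite (affected_circlesP triv pm al hp) cards2; case: (_ != _).
Qed.

Lemma card_affected p al :
  #|[pred c : circle M al | affected M p (val c)]| = #|affected_circles M p al|.
Proof.
rewrite -(card_imset _ val_inj); apply: eq_card => c.
apply/imsetP/idP => [[d dp ->]|]; first by rewrite inE (valP d).
by rewrite inE => /andP[cC cp]; exists (Sub c cC).
Qed.

Section Flip.
Variables (p : 'I_l) (al be : resolution l) (al_be : flips p al be).

Lemma flips_unaffected c : c \in circles M al -> ~~ affected M p c ->
  c \in circles M be.
Proof. by case: al_be => _ eq; apply: unaffected_circle. Qed.

Lemma flips_circles : (#|circles M al| + #|affected_circles M p be|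
  = #|circles M be| + #|affected_circles M p al|)%N.
Proof.
have cardE ga : (#|circles M ga| = #|affected_circles M p ga|
    + #|[set c in circles M ga | ~~ affected M p c]|)%N.
  rewrite -(cardsID [set c | affected M p c]); congr (_ + _)%N.
    by apply: eq_card => c; rewrite !inE.
  by apply: eq_card => c; rewrite !inE andbC.
rewrite !cardE; suff -> : [set c in circles M al | ~~ affected M p c]
  = [set c in circles M be | ~~ affected M p c] by lia.
apply/setP => c; rewrite !inE; apply/andP/andP => -[cC c_far]; split=> //.
  exact: flips_unaffected.
by case: (flips_sym al_be) => _ eq; apply: (unaffected_circle triv pm eq).
Qed.
End Flip.

Lemma agreeP p al be (f : labeling M n al) (g : labeling M n be) : flips p al be ->
  agree p f g = [forall d, ~~ affected M p (val d) ==> (g d == extend be f d)].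
Proof.
move=> al_be; apply/'forall_forallP/forallP => [fg d|gE c d].
  apply/implyP => d_far; rewrite ffunE.
  have dC := flips_unaffected (flips_sym al_be) (valP d) d_far.
  rewrite (insubT (fun c => c \in circles M al) dC) /= eq_sym.
  by have /implyP := fg (Sub (val d) dC) d; apply; rewrite eqxx.
apply/implyP => /andP[/eqP cd c_far]; have := gE d.
by rewrite -cd c_far /= ffunE -cd valK /= eq_sym.
Qed.

Lemma big_unaffected (R : Type) (idx : R) (op : Monoid.com_law idx) p al be
    (f : labeling M n al) (F : {set dart G} -> 'I_n -> R) : flips p al be ->
  \big[op/idx]_(c : circle M al | ~~ affected M p (val c)) F (val c) (f c)
  = \big[op/idx]_(d : circle M be | ~~ affected M p (val d))
      F (val d) (extend be f d).
Proof.
move=> al_be; have [h hp] := tnth_dart pm p; have hM := tnth_matched hp.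
have xU := side_unmatched triv pm true hM.
(* The defaults of [insubd] are affected circles, so that a circle missing from the other state
   falls outside the range of the product. *)
pose c0 : circle M al := exist (fun c => c \in circles M al) _ (circle_of_mem al xU).
pose d0 : circle M be := exist (fun c => c \in circles M be) _ (circle_of_mem be xU).
have far := flips_unaffected (flips_sym al_be).
have far' := flips_unaffected al_be.
rewrite (reindex_onto (fun d : circle M be => insubd c0 (val d))
  (fun c : circle M al => insubd d0 (val c))) /=; last first.
  move=> c c_far; apply: val_inj.
  by rewrite !val_insubd (far' _ (valP c) c_far) (valP c).
apply: eq_big => [d|d /andP[]].
  have [dC|dC] := boolP (val d \in circles M al); last first.
    have -> : affected M p (val d) by apply: contraNT dC; apply: far (valP d).
    apply/negbTE; rewrite negb_and negbK.
    rewrite val_insubd (negPf dC); apply/orP; left.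
    by apply/affectedP; exists true, h; rewrite mem_circle_of.
  have -> : insubd d0 (val (insubd c0 (val d))) = d.
    by apply: val_inj; rewrite !val_insubd dC (valP d).
  by rewrite val_insubd dC eqxx andbT.
rewrite val_insubd; case: ifP => [dC _ _|dC]; last first.
  by case/negP; apply/affectedP; exists true, h; rewrite mem_circle_of.
by rewrite ffunE /insubd (insubT (fun c => c \in circles M al) dC).
Qed.

(** The sum factors over the circles of the target: on an unaffected circle [agree] keeps only the
    label given by f, on an affected one the label runs freely with weight K. *)
Lemma sum_agree (R : comNzRingType) (z : {set dart G} -> R) p al be
    (f : labeling M n al) (K : circle M be -> 'I_n -> R) : flips p al be ->
  \sum_(g : labeling M n be) (agree p f g)%:R
      * \prod_(d : circle M be | affected M p (val d)) K d (g d)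
      * \prod_(d : circle M be) z (val d) ^+ g d
  = \prod_(d : circle M be | affected M p (val d))
        (\sum_(i < n) K d i * z (val d) ^+ i)
    * \prod_(c : circle M al | ~~ affected M p (val c)) z (val c) ^+ f c.
Proof.
move=> al_be; rewrite (big_unaffected _ _ (fun c i => z c ^+ i) al_be).
pose F (d : circle M be) (i : 'I_n) := (if affected M p (val d) then K d i
  else (i == extend be f d)%:R) * z (val d) ^+ i.
transitivity (\sum_(g : labeling M n be) \prod_d F d (g d)).
  apply: eq_bigr => g _; rewrite /F big_split /=; congr (_ * _).
  rewrite mulrC [RHS](bigID (fun d : circle M be => affected M p (val d))) /=.
  congr (_ * _); first by apply: eq_bigr => d ->.
  rewrite (agreeP _ _ al_be); case: forallP => [gE|gE].
    rewrite big1 // => d d_far; rewrite (negPf d_far).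
    by have /implyP/(_ d_far) -> := gE d.
  have /existsP[d] :
      [exists d, ~~ (~~ affected M p (val d) ==> (g d == extend be f d))].
    by apply: contra_notT gE => /existsPn gE d; have := gE d; rewrite negbK.
  rewrite negb_imply => /andP[d_far /negPf gd].
  by rewrite (bigD1 d) //= (negPf d_far) gd mul0r.
rewrite -bigA_distr_bigA (bigID (fun d : circle M be => affected M p (val d))) /=.
congr (_ * _); apply: eq_bigr => d d_aff; rewrite /F.
  by apply: eq_bigr => i _; rewrite d_aff.
rewrite (bigD1 (extend be f d)) //= (negPf d_aff) eqxx mul1r big1 ?addr0 //.
by move=> i /negPf->; rewrite mul0r.
Qed.

Definition compatible (R : eqType) al (z : dart G -> R) :=
  forall c, c \in circles M al -> {in c &, forall u v, z u = z v}.

Section Site.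
Variables (R : eqType) (z : dart G -> R) (p : 'I_l) (h : dart G).
Hypothesis hp : h \in tnth M p.

Lemma mem_affected al c : c \in circles M al -> affected M p c ->
  c = circle_of M al (r h) \/ c = circle_of M al (rotV h).
Proof.
move=> cC cp; have := affected_circlesP triv pm al hp.
by move=> /setP/(_ c); rewrite !inE cC cp => /esym/orP[]/eqP; [left | right].
Qed.

(** A half-edge of an affected circle of [al] also lies on an affected circle of [be]. There z takes
    its value at [r h] or at [rotV h], and these coincide. *)
Lemma flips_compatible al be : flips p al be -> compatible be z ->
  z (r h) = z (rotV h) -> compatible al z.
Proof.
move=> al_be be_z zh c cC; have hM := tnth_matched hp.
have [c_aff|c_far] := boolP (affected M p c); last first.
  exact: be_z (flips_unaffected al_be cC c_far).
suff zE u : u \in c -> z u = z (r h) by move=> u v /zE-> /zE->.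
move=> uc; have [uU cE] := mem_circle triv pm cC uc.
have uC := circle_of_mem be uU; have um := mem_circle_of M be u.
have u_aff : affected M p (circle_of M be u).
  apply: contraTT c_aff => u_far.
  by rewrite cE -(circle_eq triv pm (flips_unaffected (flips_sym al_be) uC u_far)
    (circle_of_mem al uU) um (mem_circle_of M al u)).
case: (mem_affected uC u_aff) => uE; rewrite uE in uC um.
  exact: be_z uC _ _ um (mem_circle_of _ _ _).
by rewrite zh; exact: be_z uC _ _ um (mem_circle_of _ _ _).
Qed.

Lemma affected_const al : #|affected_circles M p al| = 1%N -> compatible al z ->
  z (r h) = z (rotV h).
Proof.
rewrite (affected_circlesP triv pm al hp) cards2; case: eqP => // al_eq _ al_z.
have hM := tnth_matched hp; have rU := side_unmatched triv pm true hM.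
apply: (al_z _ (circle_of_mem al rU)); first exact: mem_circle_of.
by rewrite /= al_eq mem_circle_of.
Qed.
End Site.

Lemma affected_value (R : nzRingType) (z : dart G -> R) p h al c :
  h \in tnth M p -> compatible al z -> z (r h) = z (rotV h) ->
  c \in circles M al -> affected M p c -> set_value z c = z (r h).
Proof.
move=> hp al_z zh cC cp; have := mem_affected hp cC cp.
by case=> cE; [|rewrite zh]; apply: set_valueE (al_z _ cC) _;
  rewrite cE mem_circle_of.
Qed.
End States.

(** * Edge maps on roots of unity *)

(** For y = z every term is z^n = 1; otherwise [subrXX] shows that z - y kills the sum. It serves
    both the coproduct and the orthogonality of characters. *)
Lemma sum_geometric (R : idomainType) n (y z : R) : (0 < n)%N ->
  y ^+ n = 1 -> z ^+ n = 1 ->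
  \sum_(i < n) y ^+ i * z ^+ (n - i) = (y == z)%:R * n%:R.
Proof.
move=> n_gt0 yn zn; case: eqVneq => [->|neq].
  rewrite mul1r -[n in RHS]card_ord -sumr_const; apply: eq_bigr => i _.
  by rewrite -exprD subnKC ?zn // ltnW.
have /eqP := subrXX z y n; rewrite yn zn subrr eq_sym mulf_eq0 subr_eq0.
rewrite eq_sym (negPf neq) /= => /eqP/(congr1 ( *%R^~ z)); rewrite !mul0r.
apply: etrans; rewrite mulr_suml; apply: eq_bigr => i _.
by rewrite mulrAC -exprSr mulrC; congr (_ ^+ _ * _); have := ltn_ord i; lia.
Qed.

Section Transform.
Variables (G : ribbonGraph) (l : nat) (M : l.-tuple {set dart G}).
Hypothesis triv : trivalent G.
Hypothesis pm : perfect_matching M.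
Variables (n : nat) (n_gt0 : (0 < n)%N).
Implicit Types (x y h u v : dart G) (p q : 'I_l) (al be : resolution l).

Notation r := (rotation G).
Notation naff p al := #|affected_circles M p al|.

Definition evaluate (R : comNzRingType) (z : dart G -> R) al
    (f : labeling M n al) : R :=
  \prod_(c : circle M al) set_value z (val c) ^+ f c.

Definition affected_list p al : seq (circle M al) :=
  enum [pred c : circle M al | affected M p (val c)].

Lemma big_affected (R : Type) (idx : R) (op : Monoid.com_law idx) p al F :
  \big[op/idx]_(c : circle M al | affected M p (val c)) F c
  = \big[op/idx]_(c <- affected_list p al) F c.
Proof. by rewrite /affected_list big_enum. Qed.

Lemma size_affected_list p al : size (affected_list p al) = naff p al.
Proof. by rewrite -cardE card_affected. Qed.

Lemma mem_affected_list p al c : c \in affected_list p al -> affected M p (val c).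
Proof. by rewrite mem_enum. Qed.

(** Fusion, split, or one circle to one; two circles cannot become two, by [affected_card]. *)
Lemma flip_cases p al be : flips p al be ->
  [\/ exists c1 c2 d, affected_list p al = [:: c1; c2] /\ affected_list p be = [:: d],
      exists c d1 d2, affected_list p al = [:: c] /\ affected_list p be = [:: d1; d2]
    | exists c d, affected_list p al = [:: c] /\ affected_list p be = [:: d]].
Proof.
move=> [al_be al_be_eq].
have := naff_bounds triv pm p al; have := naff_bounds triv pm p be.
have := affected_card triv pm al_be al_be_eq.
rewrite -!size_affected_list.
case: (affected_list p al) => [|c1 [|c2 [|? ?]]] //;
  case: (affected_list p be) => [|d1 [|d2 [|? ?]]] //.
- by move=> _ _ _; apply: Or33; exists c1, d1.
- by move=> _ _ _; apply: Or32; exists c1, d1, d2.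
- by move=> _ _ _; apply: Or31; exists c1, c2, d1.
- by move/(_ erefl).
Qed.

Section Values.
Variables (R : fieldType) (s : R) (z : dart G -> R).
Hypothesis s2 : s ^+ 2 = n%:R.
Hypothesis zn : forall x, z x ^+ n = 1.

Lemma set_value_exp c : set_value z c ^+ n = 1.
Proof. by rewrite /set_value; case: pickP => //= _; rewrite expr1n. Qed.

(** The exponent is 0 for a fusion, 2 for a split and 1 for one circle to one. In a split the factor
    s^2 = n comes from [sum_geometric]. *)
Lemma edge_transform p al be (f : labeling M n al) h :
  flips p al be -> h \in tnth M p -> compatible M be z ->
  \sum_(g : labeling M n be) edge_coef s true p f g * evaluate z g
  = (z (r h) == z (rotV h))%:R * (s * z (r h) ^+ n./2) ^+ ((naff p be).+1 - naff p al)
    * evaluate z f.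
Proof.
move=> al_be hp be_z.
have values_al c : z (r h) = z (rotV h) -> c \in affected_list p al ->
    set_value z (val c) = z (r h).
  move=> zh c_aff; have al_z := flips_compatible triv pm hp al_be be_z zh.
  exact: (affected_value triv pm hp al_z zh (valP c) (mem_affected_list c_aff)).
have values_be d : z (r h) = z (rotV h) -> d \in affected_list p be ->
    set_value z (val d) = z (r h).
  move=> zh d_aff.
  exact: (affected_value triv pm hp be_z zh (valP d) (mem_affected_list d_aff)).
have transform (K : circle M be -> 'I_n -> R) :
  \sum_(g : labeling M n be) (agree p f g)%:R
      * \prod_(d <- affected_list p be) K d (g d) * evaluate z g
  = \prod_(d <- affected_list p be) (\sum_(i < n) K d i * set_value z (val d) ^+ i)
    * \prod_(c : circle M al | ~~ affected M p (val c)) set_value z (val c) ^+ f c.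
  rewrite -!big_affected -(sum_agree triv pm n_gt0 _ _ _ al_be).
  by apply: eq_bigr => g _; rewrite big_affected.
have evaluateE : evaluate z f
    = \prod_(c <- affected_list p al) set_value z (val c) ^+ f c
      * \prod_(c : circle M al | ~~ affected M p (val c)) set_value z (val c) ^+ f c.
  rewrite -big_affected /evaluate.
  by rewrite (bigID (fun c : circle M al => affected M p (val c))).
have agreeE g t : (if agree p f g then t else 0) = (agree p f g)%:R * t :> R.
  by case: agree; rewrite ?mul1r ?mul0r.
rewrite -!size_affected_list evaluateE.
(* A single affected circle in the target passes through both [r h] and [rotV h], which forces equal
   values when circles fuse or one becomes one. *)
have al1 : size (affected_list p be) = 1%N -> z (r h) = z (rotV h).
  rewrite size_affected_list => be1; apply: (affected_const triv pm hp be1 be_z).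
case: (flip_cases al_be) =>
  [[c1 [c2 [d [alE beE]]]]|[c [d1 [d2 [alE beE]]]]|[c [d [alE beE]]]].
- have zh : z (r h) = z (rotV h) by apply: al1; rewrite beE.
  pose K (_ : circle M be) (i : 'I_n) : R := mul_coef R true (f c1) (f c2) i.
  have := transform K; rewrite alE beE !big_cons !big_nil !mulr1 zh eqxx mul1r.
  rewrite sum_exp_eq ?set_value_exp // (values_be d) ?beE ?mem_head //.
  rewrite (values_al c1) ?alE ?mem_head // (values_al c2) ?alE ?inE ?eqxx ?orbT //.
  rewrite exprD => <-; apply: eq_bigr => g _; rewrite /edge_coef -/(agree p f g).
  rewrite -/(affected_list p al) -/(affected_list p be) alE beE agreeE.
  by rewrite big_seq1.
- have d12 : d2 != d1.
    by have := enum_uniq [pred d : circle M be | affected M p (val d)];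
      rewrite -/(affected_list p be) beE /= inE andbT eq_sym.
  (* The coproduct is not a product over the two circles, but becomes a sum of such products once
     the label t of d1 is fixed: then d2 carries the residue of a - t, written with n - t to stay in
     the natural numbers. *)
  pose a := (f c + n./2.*2)%N.
  pose t2 (t : 'I_n) : 'I_n := Ordinal (ltn_pmod (a + (n - t)) n_gt0).
  pose K (t : 'I_n) (d : circle M be) (i : 'I_n) : R :=
    (i == if d == d1 then t else t2 t)%:R.
  have comulE g : comul_coef R true (f c) (g d1) (g d2)
      = \sum_t \prod_(d <- [:: d1; d2]) K t d (g d).
    rewrite (bigD1 (g d1)) //= !big_cons big_nil /K eqxx (negPf d12) eqxx.
    rewrite mul1r mulr1 big1 ?addr0 => [|t]; last first.
      by rewrite big_cons eqxx eq_sym => /negPf->; rewrite mul0r.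
    congr (_%:R); rewrite /exp_eq -val_eqE /= -/a; congr nat_of_bool.
    rewrite -[in RHS](modn_small (ltn_ord (g d2))) -[RHS](eqn_modDl (g d1)).
    by rewrite [in RHS]addnCA subnKC ?modnDr 1?eq_sym // ltnW.
  transitivity (\sum_t \sum_(g : labeling M n be) (agree p f g)%:R
      * \prod_(d <- affected_list p be) K t d (g d) * evaluate z g).
    rewrite exchange_big; apply: eq_bigr => g _; rewrite -mulr_suml -mulr_sumr.
    rewrite beE -comulE; congr (_ * _); rewrite /edge_coef -/(agree p f g).
    by rewrite -/(affected_list p al) -/(affected_list p be) alE beE agreeE.
  rewrite (eq_bigr _ (fun t _ => transform (K t))) beE.
  rewrite -mulr_suml.
  have sumK t d : \sum_(i < n) K t d i * set_value z (val d) ^+ i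
      = set_value z (val d) ^+ (if d == d1 then t else t2 t).
    rewrite /K; set j := (if _ then _ else _).
    rewrite (bigD1 j) //= eqxx mul1r big1 ?addr0 // => i /negPf->.
    by rewrite mul0r.
  have -> : \sum_t \prod_(d <- [:: d1; d2])
        \sum_(i < n) K t d i * set_value z (val d) ^+ i
      = (set_value z (val d1) == set_value z (val d2))%:R * n%:R
        * set_value z (val d2) ^+ a.
    rewrite -(sum_geometric n_gt0) ?set_value_exp // mulr_suml.
    apply: eq_bigr => t _.
    rewrite !big_cons big_nil mulr1 !sumK eqxx (negPf d12) /t2 /=.
    by rewrite (expr_mod _ (set_value_exp _)) [(a + _)%N]addnC exprD mulrA.
  rewrite alE big_seq1 -!mulrA.
  case: (eqVneq (z (r h)) (z (rotV h))) => [zh|zh].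
    rewrite (values_be d1) ?beE ?mem_head // (values_be d2) ?beE ?inE ?eqxx ?orbT //.
    rewrite ?eqxx (values_al c) ?alE ?mem_head // -s2 /a addnC exprD -addnn exprD.
    move: (z _ ^+ n./2) (z _ ^+ f c) (\prod_(_ | _) _) => x y w; ring.
  (* The distinct circles d1 and d2 pass one through [r h] and the other through [rotV h], so they
     carry the two different values of z. *)
  suff /negPf-> : set_value z (val d1) != set_value z (val d2) by rewrite !mul0r.
  have valE d : d \in affected_list p be -> exists b, val d = circle_of M be (side b h)
      /\ set_value z (val d) = z (side b h).
    move=> /mem_affected_list d_aff.
    suff [b dE] : exists b, val d = circle_of M be (side b h).
      exists b; split=> //; apply: set_valueE (be_z _ (valP d)) _.
      by rewrite dE mem_circle_of.
    case: (mem_affected triv pm hp (valP d) d_aff) => ->; first by exists true.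
    by exists false.
  have [|b1 [v1 ->]] := valE d1; first by rewrite beE mem_head.
  have [|b2 [v2 ->]] := valE d2; first by rewrite beE !inE eqxx orbT.
  move: d12; rewrite -val_eqE v1 v2.
  by case: b1 b2 {v1 v2} => -[]; rewrite ?eqxx //= => _; rewrite // eq_sym.
- have zh : z (r h) = z (rotV h) by apply: al1; rewrite beE.
  pose K (_ : circle M be) (i : 'I_n) : R := eta_coef s true (f c) i.
  have := transform K; rewrite alE beE !big_cons !big_nil !mulr1 zh eqxx mul1r.
  have -> : \sum_(i < n) K d i * set_value z (val d) ^+ i
      = s * set_value z (val d) ^+ (f c + n./2).
    rewrite -(sum_exp_eq _ n_gt0) ?set_value_exp // mulr_sumr.
    by apply: eq_bigr => i _; rewrite mulrA.
  rewrite (values_be d) ?beE ?mem_head // (values_al c) ?alE ?mem_head //.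
  rewrite -zh exprD [_ ^+ f c * _]mulrC mulrA expr1 -!mulrA => <-.
  apply: eq_bigr => g _; rewrite /edge_coef -/(agree p f g).
  rewrite -/(affected_list p al) -/(affected_list p be) alE beE agreeE.
  by rewrite big_seq1.
Qed.
End Values.
End Transform.

(** * Squares of states *)

Section Composite.
Variables (G : ribbonGraph) (l : nat) (M : l.-tuple {set dart G}).
Hypothesis triv : trivalent G.
Hypothesis pm : perfect_matching M.
Variables (n : nat) (n_gt0 : (0 < n)%N).
Implicit Types (x y h u v : dart G) (p q : 'I_l) (al be ga : resolution l).

Notation r := (rotation G).
Notation naff p al := #|affected_circles M p al|.

Definition composite (k : comPzRingType) (s : k) p q al ga be
    (f : labeling M n al) (h : labeling M n be) : k :=
  \sum_(g : labeling M n ga) edge_coef s true p f g * edge_coef s true q g h.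

Definition separated p q al :=
  forall c, c \in circles M al -> ~~ (affected M p c && affected M q c).

Lemma separated_sym p q al : separated p q al -> separated q p al.
Proof. by move=> sep c /sep; rewrite andbC. Qed.

(** A circle meeting the p-th edge does not meet the q-th one, so it survives the change at q; no
    new one can arise, since it would share a half-edge with such a survivor. *)
Lemma separated_flip p q al be : flips q al be -> separated p q al ->
  naff p be = naff p al /\ separated p q be.
Proof.
move=> al_be sep; have be_al := flips_sym al_be.
have be_in c : c \in circles M be -> affected M p c -> c \in circles M al.
  move=> cC cp; have [cq|c_far] := boolP (affected M q c); last first.
    exact: (flips_unaffected triv pm be_al).
  have /affectedP[b [h [hp hc]]] := cp; have [hU cE] := mem_circle triv pm cC hc.
  have cC' := circle_of_mem al hU; have hc' := mem_circle_of M al (side b h).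
  have cp' : affected M p (circle_of M al (side b h)).
    by apply/affectedP; exists b, h.
  have cq' : ~~ affected M q (circle_of M al (side b h)).
    by have := sep _ cC'; rewrite cp'.
  have := circle_eq triv pm (flips_unaffected triv pm al_be cC' cq') cC hc' hc.
  by move=> cE'; rewrite -cE' (negPf cq') in cq.
split; last first.
  move=> c cC; apply/negP => /andP[cp cq].
  by have := sep c (be_in c cC cp); rewrite cp cq.
apply: eq_card => c; rewrite !inE; apply/andP/andP => -[cC cp]; split=> //.
  exact: be_in.
by apply: (flips_unaffected triv pm al_be) => //; have := sep c cC; rewrite cp.
Qed.

Lemma naff_cases p al be : flips p al be ->
  [\/ naff p al = 2%N /\ naff p be = 1%N, naff p al = 1%N /\ naff p be = 2%N
    | naff p al = 1%N /\ naff p be = 1%N].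
Proof.
move=> /(flip_cases triv pm); rewrite -!size_affected_list.
case=> [[c1 [c2 [d [-> ->]]]]|[c [d1 [d2 [-> ->]]]]|[c [d [-> ->]]]].
- exact: Or31.
- exact: Or32.
- exact: Or33.
Qed.

(** The exponent is one plus the change in the number of circles, so that it telescopes along a path
    of states. *)
Lemma flip_exponent p al be : flips p al be ->
  ((naff p be).+1 - naff p al + #|circles M al| = #|circles M be|.+1)%N.
Proof.
move=> al_be; have := flips_circles triv pm n_gt0 al_be.
by case: (naff_cases al_be) => -[-> ->]; lia.
Qed.

Lemma composite_transform p q al ga be (R : fieldType) (s : R) (z : dart G -> R)
    (f : labeling M n al) hp hq :
  flips p al ga -> flips q ga be -> s ^+ 2 = n%:R ->
  (forall x, z x ^+ n = 1) -> compatible M be z ->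
  hp \in tnth M p -> hq \in tnth M q ->
  \sum_(h : labeling M n be) composite s p q ga f h * evaluate z h
  = (z (r hq) == z (rotV hq))%:R * (z (r hp) == z (rotV hp))%:R
    * ((s * z (r hq) ^+ n./2) ^+ ((naff q be).+1 - naff q ga)
    * (s * z (r hp) ^+ n./2) ^+ ((naff p ga).+1 - naff p al)) * evaluate z f.
Proof.
move=> al_ga ga_be s2 zn be_z hpp hqq.
transitivity (\sum_(g : labeling M n ga) edge_coef s true p f g
    * \sum_(h : labeling M n be) edge_coef s true q g h * evaluate z h).
  under eq_bigr do rewrite /composite mulr_suml.
  rewrite exchange_big; apply: eq_bigr => g _; rewrite mulr_sumr.
  by apply: eq_bigr => h _; rewrite mulrA.
under eq_bigr do rewrite (edge_transform triv pm n_gt0 s2 zn _ ga_be hqq be_z).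
case: (eqVneq (z (r hq)) (z (rotV hq))) => [zq|_]; last first.
  by rewrite !mul0r big1 // => g _; rewrite !mul0r mulr0.
have ga_z := flips_compatible triv pm hqq ga_be be_z zq.
rewrite !mul1r; under [LHS]eq_bigr => g _ do rewrite mulrCA.
rewrite -mulr_sumr (edge_transform triv pm n_gt0 s2 zn _ al_ga hpp ga_z).
by rewrite !mulrA; congr (_ * _); rewrite mulrAC mulrC mulrA.
Qed.

Lemma composite_transform_sym p q al ga ga' be (R : fieldType) (s : R) (z : dart G -> R)
    (f : labeling M n al) :
  flips p al ga -> flips q ga be -> flips q al ga' -> flips p ga' be ->
  s ^+ 2 = n%:R -> (forall x, z x ^+ n = 1) -> compatible M be z ->
  \sum_(h : labeling M n be) composite s p q ga f h * evaluate z h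
  = \sum_(h : labeling M n be) composite s q p ga' f h * evaluate z h.
Proof.
move=> al_ga ga_be al_ga' ga'_be s2 zn be_z.
have [hp hpp] := tnth_dart pm p; have [hq hqq] := tnth_dart pm q.
rewrite (composite_transform f al_ga ga_be s2 zn be_z hpp hqq).
rewrite (composite_transform f al_ga' ga'_be s2 zn be_z hqq hpp).
case: (eqVneq (z (r hp)) (z (rotV hp))) => [zp|_]; last by rewrite !(mul0r, mulr0).
case: (eqVneq (z (r hq)) (z (rotV hq))) => [zq|_]; last by rewrite !(mul0r, mulr0).
rewrite !mul1r; congr (_ * _).
(* If a circle of the final state meets both edges, z has one value on both and only the total
   exponent matters; otherwise the two factors are merely exchanged. *)
have [[c [cC /andP[cp cq]]]|sep] :
    (exists c, c \in circles M be /\ affected M p c && affected M q c)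
    \/ separated p q be.
- have [/existsP[c /andP[cC cpq]]|/existsPn none] :=
    boolP [exists c, (c \in circles M be) && (affected M p c && affected M q c)].
    by left; exists c.
  by right=> c cC; have := none c; rewrite cC.
- rewrite -(affected_value triv pm hpp be_z zp cC cp).
  rewrite -(affected_value triv pm hqq be_z zq cC cq) -!exprD; congr (_ ^+ _).
  have := flip_exponent al_ga; have := flip_exponent ga_be.
  by have := flip_exponent al_ga'; have := flip_exponent ga'_be; lia.
(* Separation is carried back from [be] around the square, so each edge has the same numbers of
   affected circles in both orders. *)
have [q_be p_ga'] := separated_flip (flips_sym ga'_be) (separated_sym sep).
have [p_be sep_ga] := separated_flip (flips_sym ga_be) sep.
have [q_ga sep_al] := separated_flip (flips_sym al_ga) (separated_sym sep_ga).
have [p_al _] := separated_flip al_ga' (separated_sym sep_al).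
by rewrite mulrC; congr (_ ^+ _ * _ ^+ _); lia.
Qed.
End Composite.

(** * Commuting squares, from the algebraic numbers to any ring *)

Section Commute.
Variables (G : ribbonGraph) (l : nat) (M : l.-tuple {set dart G}).
Hypothesis triv : trivalent G.
Hypothesis pm : perfect_matching M.
Variables (n : nat) (n_gt0 : (0 < n)%N).
Implicit Types (x y h u v : dart G) (p q : 'I_l) (al be ga : resolution l).

Notation r := (rotation G).
Notation naff p al := #|affected_circles M p al|.

Section Characters.
Variables (R : numFieldType) (zeta : R).
Hypothesis zeta_prim : n.-primitive_root zeta.

(** The assignment of the root of unity zeta^(w c) to each circle c. Half-edges on no circle get 1,
    so that all values are n-th roots of unity. *)
Definition character al (w : labeling M n al) x : R :=
  oapp (fun c => zeta ^+ w c) 1 [pick c : circle M al | x \in val c].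

Lemma characterE al (w : labeling M n al) (c : circle M al) x :
  x \in val c -> character w x = zeta ^+ w c.
Proof.
move=> xc; rewrite /character; case: pickP => [d xd|/(_ c)]; last by rewrite xc.
rewrite /=; congr (_ ^+ w _); apply: val_inj.
exact: (circle_eq triv pm (valP d) (valP c) xd xc).
Qed.

Lemma character_exp al (w : labeling M n al) x : character w x ^+ n = 1.
Proof.
rewrite /character; case: pickP => [c _|_] /=; last by rewrite expr1n.
by rewrite -exprM mulnC exprM (prim_expr_order zeta_prim) expr1n.
Qed.

Lemma character_compatible al (w : labeling M n al) :
  compatible M al (character w).
Proof.
move=> c cC x y xc yc.
pose c' : circle M al := exist (fun c => c \in circles M al) c cC.
by rewrite !(characterE w (c := c')).
Qed.

Lemma evaluate_character al (w f : labeling M n al) :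
  evaluate (character w) f = \prod_(c : circle M al) (zeta ^+ w c) ^+ f c.
Proof.
apply: eq_bigr => c _; congr (_ ^+ _).
have [x xc] := circle_neq0 (valP c).
by rewrite (set_valueE (character_compatible w (valP c)) xc) (characterE _ xc).
Qed.

(** Fourier inversion: summing over all characters with weights D w isolates C f0, multiplied by a
    power of n, which is nonzero in a [numFieldType]. *)
Lemma evaluate_inj al (C : labeling M n al -> R) :
  (forall z : dart G -> R, (forall x, z x ^+ n = 1) -> compatible M al z ->
    \sum_(f : labeling M n al) C f * evaluate z f = 0) ->
  forall f, C f = 0.
Proof.
move=> C0 f0; pose D (w : labeling M n al) := \prod_c (zeta ^+ f0 c) ^+ (n - w c).
have orth f : \sum_(w : labeling M n al) evaluate (character w) f * D w
    = (f == f0)%:R * n%:R ^+ #|[pred c : circle M al | true]|.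
  transitivity (\prod_(c : circle M al)
      \sum_(i < n) (zeta ^+ f c) ^+ i * (zeta ^+ f0 c) ^+ (n - i)).
    rewrite bigA_distr_bigA; apply: eq_bigr => w _.
    rewrite evaluate_character -big_split; apply: eq_bigr => c _ /=.
    by rewrite exprAC.
  have rootE i : (zeta ^+ i) ^+ n = 1.
    by rewrite -exprM mulnC exprM (prim_expr_order zeta_prim) expr1n.
  under eq_bigr => c _ do rewrite (sum_geometric n_gt0 (rootE _) (rootE _))
    (eq_prim_root_expr zeta_prim) !modn_small //.
  rewrite big_split prodr_const; congr (_ * _).
  have [->|neq] := eqVneq f f0; first by rewrite big1 // => c _; rewrite eqxx.
  have [c fc] : exists c, f c != f0 c.
    apply/existsP; apply: contraNT neq => /existsPn eq_f.
    by apply/eqP/ffunP => c; apply/eqP/negPn.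
  by rewrite (bigD1 c) //= [_ == _](negPf fc) mul0r.
have : \sum_(w : labeling M n al) D w
    * (\sum_(f : labeling M n al) C f * evaluate (character w) f) = 0.
  rewrite big1 // => w _; rewrite C0 ?mulr0 //; first exact: character_exp.
  exact: character_compatible.
have -> : \sum_(w : labeling M n al) D w
    * (\sum_(f : labeling M n al) C f * evaluate (character w) f)
  = \sum_(f : labeling M n al) C f
    * ((f == f0)%:R * n%:R ^+ #|[pred c : circle M al | true]|).
  rewrite -[RHS](eq_bigr _ (fun f _ => congr1 ( *%R (C f)) (orth f))).
  rewrite [RHS](eq_bigr _ (fun f _ => mulr_sumr _ _ _ _)) exchange_big.
  apply: eq_bigr => w _; rewrite mulr_sumr; apply: eq_bigr => f _.
  by rewrite mulrC mulrA.
rewrite (bigD1 f0) //= big1 ?addr0 => [|f /negPf neq]; last first.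
  by rewrite neq mul0r mulr0.
rewrite eqxx mul1r => /eqP; rewrite mulf_eq0 => /orP[/eqP //|].
by rewrite expf_eq0 pnatr_eq0 eqn0Ngt n_gt0 andbF.
Qed.
End Characters.

(** The root s occurs only in eta, that is when one affected circle becomes one; all other structure
    constants are 0 or 1. *)
Lemma edge_coef_int (k : comPzRingType) (s : k) p al be (f : labeling M n al)
    (g : labeling M n be) : flips p al be ->
  edge_coef s true p f g = s ^+ (naff p al == naff p be)
    * (edge_coef (1 : int) true p f g)%:~R.
Proof.
move=> al_be; rewrite /edge_coef -!size_affected_list.
case: ifP => _; last by rewrite mulr0z mulr0.
rewrite -/(affected_list M p al) -/(affected_list M p be).
have natE (b : bool) : (b%:R : int)%:~R = b%:R :> k by case: b.
case: (flip_cases triv pm al_be) =>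
  [[c1 [c2 [d [-> ->]]]]|[c [d1 [d2 [-> ->]]]]|[c [d [-> ->]]]] /=.
- by rewrite mul1r natE.
- by rewrite mul1r natE.
- by rewrite expr1 /eta_coef mul1r natE.
Qed.

Lemma composite_int (k : comPzRingType) (s : k) p q al ga be (f : labeling M n al)
    (h : labeling M n be) : flips p al ga -> flips q ga be ->
  composite s p q ga f h = s ^+ ((naff p al == naff p ga) + (naff q ga == naff q be))
    * (composite (1 : int) p q ga f h)%:~R.
Proof.
move=> al_ga ga_be; rewrite rmorph_sum mulr_sumr; apply: eq_bigr => g _.
rewrite (edge_coef_int s _ _ al_ga) (edge_coef_int s _ _ ga_be) exprD rmorphM.
by rewrite mulrACA.
Qed.

(* The identity is first obtained over the algebraic numbers, where it can be
   tested on characters, and then transferred: both sides are a power of s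
   times an integer, and these powers agree up to s^2 = n. *)
Lemma composite_comm (k : comPzRingType) (s : k) p q al ga ga' be
    (f : labeling M n al) (h : labeling M n be) :
  flips p al ga -> flips q ga be -> flips q al ga' -> flips p ga' be ->
  s ^+ 2 = n%:R -> composite s p q ga f h = composite s q p ga' f h.
Proof.
move=> al_ga ga_be al_ga' ga'_be s2.
pose t : algC := sqrtC n%:R; have t2 : t ^+ 2 = n%:R by rewrite sqrtCK.
have t_neq0 : t != 0 by rewrite sqrtC_eq0 pnatr_eq0 -lt0n.
have [zeta zeta_prim] := C_prim_root_exists n_gt0.
have commC : composite t p q ga f h = composite t q p ga' f h.
  apply/eqP; rewrite -subr_eq0; apply/eqP.
  pose C (h : labeling M n be) := composite t p q ga f h - composite t q p ga' f h.
  rewrite -[LHS]/(C h); apply: (evaluate_inj zeta_prim) h => z zn be_z.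
  have CE (h' : labeling M n be) :
      C h' * evaluate z h' = composite t p q ga f h' * evaluate z h'
    - composite t q p ga' f h' * evaluate z h' by rewrite -mulrBl.
  rewrite (eq_bigr _ (fun g _ => CE g)) sumrB; apply/eqP; rewrite subr_eq0.
  by rewrite (composite_transform_sym triv pm n_gt0 f al_ga ga_be al_ga' ga'_be).
move: commC.
rewrite (composite_int t f h al_ga ga_be) (composite_int t f h al_ga' ga'_be).
rewrite (composite_int s f h al_ga ga_be) (composite_int s f h al_ga' ga'_be).
set e := (_ + _)%N; set e' := (_ + _)%N; set c := composite _ _ _ _ _ _.
set c' := composite _ _ _ _ _ _ => commC.
(* The powers count the edges that keep the number of circles. An edge of any other kind changes
   that number by one, so the parity of the count depends on [al] and [be] alone. *)
have evenE : odd e = odd e'.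
  have parity p' a b : flips p' a b ->
      odd (naff p' a == naff p' b) = ~~ odd (#|circles M a| + #|circles M b|).
    move=> ab; have := flip_exponent triv pm n_gt0 ab.
    case: (naff_cases triv pm ab) => -[-> ->]; lia.
  rewrite /e /e' !oddD !parity // !oddD.
  by move: (odd _) (odd _) (odd _) (odd _) => [] [] [] [].
have le2 : (e <= 2)%N /\ (e' <= 2)%N by split; rewrite /e /e'; do 2!case: (_ == _).
have [ee|[[ee ee']|[ee ee']]] : e = e' \/ ((e = 2 /\ e' = 0) \/ (e = 0 /\ e' = 2))%N.
- by case: le2; move: evenE; case: e {commC} => [|[|[|?]]]; case: e' => [|[|[|?]]] //; auto.
- rewrite -ee in commC *; have /mulfI /(_ _ _ commC)/intr_inj -> // : t ^+ e != 0.
  by rewrite expf_neq0.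
- move: commC; rewrite ee ee' s2 t2 !mul1r -[n%:R]/(n%:Z%:~R) -intrM => /intr_inj <-.
  by rewrite intrM.
- move: commC; rewrite ee ee' s2 t2 !mul1r -[n%:R]/(n%:Z%:~R) -intrM => /intr_inj ->.
  by rewrite intrM.
Qed.
End Commute.

(** * The differential *)

Lemma antisymmetric_sum (V : zmodType) l (S : 'I_l -> 'I_l -> V) :
  (forall p, S p p = 0) -> (forall p q : 'I_l, (p < q)%N -> S q p = - S p q) ->
  \sum_p \sum_q S p q = 0.
Proof.
move=> S0 SN.
have -> : \sum_p \sum_q S p q
    = \sum_(p < l) \sum_(q < l | (p < q)%N) S p q
      + \sum_(p < l) \sum_(q < l | (q < p)%N) S p q.
  rewrite -big_split; apply: eq_bigr => p _ /=.
  rewrite (bigID (fun q : 'I_l => (p < q)%N)) /=; congr (_ + _).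
  rewrite (bigD1 p) ?ltnn //= S0 add0r; apply: eq_bigl => q.
  by rewrite -leqNgt ltn_neqAle andbC.
rewrite [X in _ + X](exchange_big_dep xpredT) //= -big_split /= big1 // => p _.
by rewrite -big_split big1 // => q lt_pq; rewrite /= (SN _ _ lt_pq) subrr.
Qed.

Section Differential.
Variables (G : ribbonGraph) (l : nat) (M : l.-tuple {set dart G}).
Hypothesis triv : trivalent G.
Hypothesis pm : perfect_matching M.
Variables (n : nat) (n_gt0 : (0 < n)%N).
Variables (k : comPzRingType) (s : k).
Hypothesis s2 : s ^+ 2 = n%:R.
Implicit Types (p q : 'I_l) (al be ga : resolution l).

Definition upper p al : resolution l := [ffun q => (q == p) || al q].

Lemma upperE p al q : upper p al q = (q == p) || al q.
Proof. exact: ffunE. Qed.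

Lemma coversE p al be : covers p al be = ~~ al p && (be == upper p al).
Proof. by []. Qed.

Lemma covers_flips p al be : covers p al be -> flips p al be.
Proof.
move=> /andP[al_p /eqP->]; split=> [|q /negPf qp]; rewrite ffunE ?eqxx ?qp //.
by case: (al p) al_p.
Qed.

Definition height p al : nat := \sum_(q < l | (q < p)%N) al q.

(** Changing p first reverses the sign of a later change at q exactly when p < q; hence the two
    orders carry opposite signs. *)
Lemma height_upper p q al : ~~ al p ->
  height q (upper p al) = ((p < q)%N + height q al)%N.
Proof.
move=> /negPf al_p; rewrite /height.
have [lt_pq|le_qp] := ltnP p q; last first.
  apply: eq_bigr => q' lt_q'; rewrite upperE; case: eqP => // q'E.
  by move: lt_q'; rewrite q'E ltnNge le_qp.
rewrite (bigD1 p) //= [in RHS](bigD1 p) //= al_p upperE eqxx; congr (_ + _)%N.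
by apply: eq_bigr => q' /andP[_ /negPf q'p]; rewrite upperE q'p.
Qed.

Lemma weight_upper p al : ~~ al p -> weight (upper p al) = (weight al).+1.
Proof.
move=> /negPf al_p; rewrite /weight (bigD1 p) //= upperE eqxx [in RHS](bigD1 p) //= al_p.
by congr _.+1; apply: eq_bigr => q /negPf qp; rewrite upperE qp.
Qed.

Section Square.
Variables (al be : resolution l) (f : labeling M n al) (h : labeling M n be).

(** The contribution to the squared differential of changing first p and then q; the intermediate
    state can only be [upper p al]. *)
Definition square_entry p q : k :=
  (covers p al (upper p al) && covers q (upper p al) be)%:R
    * ((-1) ^+ (height p al + height q (upper p al))
    * composite s p q (upper p al) f h).

Lemma square_entry_diag p : square_entry p p = 0.
Proof. by rewrite /square_entry !coversE upperE !eqxx /= andbF mul0r. Qed.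

Lemma square_entryN p q : (p < q)%N -> square_entry q p = - square_entry p q.
Proof.
move=> lt_pq; have pq : p != q by rewrite -val_eqE neq_ltn lt_pq.
have condE : covers q al (upper q al) && covers p (upper q al) be
    = covers p al (upper p al) && covers q (upper p al) be.
  rewrite !coversE !eqxx !andbT !upperE (eq_sym q p) !(negPf pq) /= !andbA.
  rewrite [~~ al q && _]andbC; congr (_ && (_ == _)).
  by apply/ffunP => q'; rewrite !upperE orbCA.
rewrite /square_entry condE; case: (boolP (_ && _)); last by rewrite !mul0r oppr0.
move=> /[dup]; rewrite -{1}condE => /andP[al_q q_p] /andP[al_p p_q].
rewrite !mul1r (composite_comm triv pm n_gt0 f h (covers_flips al_q) (covers_flips q_p)
  (covers_flips al_p) (covers_flips p_q) s2) -mulNr; congr (_ * _).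
case/andP: al_q => al_q _; case/andP: al_p => al_p _.
rewrite !height_upper // lt_pq ltnNge (ltnW lt_pq) /= add0n add1n addnS exprS.
by rewrite mulN1r opprK addnC.
Qed.
End Square.

Lemma diff_coef_square (b d : generator M n) :
  \sum_c diff_coef s true b c * diff_coef s true c d = 0.
Proof.
case: b d => al f [be h].
apply: etrans (antisymmetric_sum (square_entry_diag f h) (@square_entryN _ _ f h)).
pose T ga (g : labeling M n ga) p q : k := (covers p al ga && covers q ga be)%:R
  * ((-1) ^+ (height p al + height q ga)
  * (edge_coef s true p f g * edge_coef s true q g h)).
transitivity (\sum_(c : generator M n) \sum_p \sum_q T _ (tagged c) p q).
  apply: eq_bigr => c _; rewrite /diff_coef mulr_suml [LHS]big_mkcond.
  apply: eq_bigr => p _; rewrite /T; case: (covers p al _); last first.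
    by rewrite big1 // => q _; rewrite mul0r.
  rewrite mulr_sumr big_mkcond; apply: eq_bigr => q _ /=.
  by case: (covers q _ be); rewrite ?mul0r // mul1r exprD mulrACA.
rewrite exchange_big; apply: eq_bigr => p _.
rewrite exchange_big; apply: eq_bigr => q _.
rewrite -(sig_big_dep (J := fun ga => labeling M n ga) xpredT (fun=> xpredT)
  (fun ga g => T ga g p q)) /=.
rewrite (bigD1 (upper p al)) //=.
rewrite [X in _ + X]big1 ?addr0 => [|ga /negPf ga_neq]; last first.
  by rewrite big1 // => g _; rewrite /T coversE ga_neq andbF mul0r.
by rewrite /T -!mulr_sumr.
Qed.

Lemma fdiff_square v : fdiff M n s (fdiff M n s v) = 0.
Proof.
apply/ffunP => d; rewrite !matrix_mapE [RHS]ffunE.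
under eq_bigr do rewrite matrix_mapE mulr_sumr.
rewrite exchange_big big1 // => b _.
transitivity ((\sum_c diff_coef s true b c * diff_coef s true c d) * v b).
  by rewrite mulr_suml; apply: eq_bigr => c _; rewrite mulrCA mulrA.
by rewrite diff_coef_square mul0r.
Qed.

(** X - Y lies strictly between -n and 2 n, where the only multiples of n are 0 and n. This is why
    the filtered differential has parts of degrees 0 and n only. *)
Lemma exp_eq_filtered X Y : (X < Y + n.*2)%N -> (Y < X + n)%N ->
  exp_eq n true X Y -> X = Y \/ X = (Y + n)%N.
Proof.
rewrite /exp_eq => lt_X lt_Y; have [le_YX|lt_XY] := leqP Y X.
  rewrite eqn_mod_dvd // => /dvdnP[c]; case: c => [|[|c]]; rewrite ?mulSn; lia.
rewrite eq_sym eqn_mod_dvd ?(ltnW lt_XY) // => /dvdnP[c].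
case: c => [|c]; rewrite ?mulSn; lia.
Qed.

(** X and Y are the total exponents before and after, with the shift of eta or Delta counted in X; t
    is 1 or s. Both theories use the same X and Y and differ only in comparing them exactly or
    modulo n. *)
Lemma edge_degree p (b c : generator M n) : covers p (tag b) (tag c) ->
  agree p (tagged b) (tagged c) ->
  exists t X Y, [/\ forall filtered, edge_coef s filtered p (tagged b) (tagged c)
                      = t * (exp_eq n filtered X Y)%:R,
      qdeg c = qdeg b + X%:Z - Y%:Z, (X < Y + n.*2)%N & (Y < X + n)%N].
Proof.
case: b c => al f [be g] /= cov agr; have al_be := covers_flips cov.
have weightE : weight be = (weight al).+1.
  by case/andP: cov => al_p /eqP->; rewrite -[finfun _]/(upper p al) weight_upper.
pose u := \sum_(c : circle M al | ~~ affected M p (val c)) ((n./2)%:Z - (f c : nat)%:Z).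
have qf : qdeg (Tagged _ f) = \sum_(c <- affected_list M p al)
    ((n./2)%:Z - (f c : nat)%:Z) + u + (n./2 * weight al)%N%:Z.
  rewrite /qdeg (bigID (fun c : circle M al => affected M p (val c))) /=.
  by rewrite big_affected.
have qg : qdeg (Tagged _ g) = \sum_(d <- affected_list M p be)
    ((n./2)%:Z - (g d : nat)%:Z) + u + (n./2 * weight al)%N%:Z + (n./2)%:Z.
  rewrite /qdeg (bigID (fun c : circle M be => affected M p (val c))) /= big_affected.
  rewrite weightE mulnS addnC PoszD addrA; congr (_ + _ + _ + _).
  rewrite /u (big_unaffected triv pm n_gt0 _ f (fun _ i => (n./2)%:Z - (i : nat)%:Z) al_be).
  apply: eq_bigr => d d_far; move: agr; rewrite (agreeP triv pm n_gt0 _ _ al_be).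
  by move=> /forallP/(_ d)/implyP/(_ d_far)/eqP->.
(* For odd n the shift of Delta is n - 1 rather than n. This still suffices in a split, where Y is
   at most 2 n - 2. *)
have half : (n <= n./2.*2.+1 /\ n./2.*2 <= n)%N by have := odd_double_half n; lia.
move: qf qg; rewrite /edge_coef -/(agree p f g) agr.
rewrite -/(affected_list M p al) -/(affected_list M p be).
case: (flip_cases triv pm al_be) =>
    [[c1 [c2 [d [-> ->]]]]|[c [d1 [d2 [-> ->]]]]|[c [d [-> ->]]]] /=;
  rewrite !big_cons !big_nil => -> ->.
- exists 1, (f c1 + f c2)%N, (g d); split=> [filtered|||]; first by rewrite mul1r.
  + by rewrite ?PoszD -?addnn ?PoszD; ring.
  + by have := ltn_ord (f c1); have := ltn_ord (f c2); lia.
  + by have := ltn_ord (g d); lia.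
- exists 1, (f c + n./2.*2)%N, (g d1 + g d2)%N; split=> [filtered|||]; first by rewrite mul1r.
  + by rewrite ?PoszD -?addnn ?PoszD; ring.
  + by have := ltn_ord (f c); lia.
  + by have := ltn_ord (g d1); have := ltn_ord (g d2); lia.
- exists s, (f c + n./2)%N, (g d); split=> [filtered|||] //.
  + by rewrite ?PoszD -?addnn ?PoszD; ring.
  + by have := ltn_ord (f c); lia.
  + by have := ltn_ord (g d); lia.
Qed.

Lemma diff_coef_degree (b c : generator M n) : diff_coef s true b c != 0 ->
  hdeg c = hdeg b + 1 /\ (qdeg c = qdeg b \/ qdeg c = qdeg b + n%:Z).
Proof.
rewrite /diff_coef => sum_neq0.
have [p /andP[cov edge_neq0]] : exists p, covers p (tag b) (tag c)
    && (edge_coef s true p (tagged b) (tagged c) != 0).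
  apply/existsP; apply: contraNT sum_neq0 => /existsPn all0; apply/eqP/big1 => p cov.
  by have := all0 p; rewrite cov negbK => /eqP->; rewrite mulr0.
have agr : agree p (tagged b) (tagged c).
  by apply: contraNT edge_neq0 => /negPf; rewrite /edge_coef /agree => ->.
have [t [X [Y [edgeE -> lt_X lt_Y]]]] := edge_degree cov agr.
split.
  case/andP: cov => al_p /eqP tagE; rewrite /hdeg tagE -[finfun _]/(upper p (tag b)).
  by rewrite weight_upper //; lia.
have /(exp_eq_filtered lt_X lt_Y) : exp_eq n true X Y.
  by apply: contraNT edge_neq0 => /negPf; rewrite edgeE => ->; rewrite mulr0.
by case=> XE; [left | right]; lia.
Qed.

Lemma diff_coef_unfiltered (b c : generator M n) :
  diff_coef s false b c = if qdeg c == qdeg b then diff_coef s true b c else 0.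
Proof.
have edgeE p : covers p (tag b) (tag c) -> edge_coef s false p (tagged b) (tagged c)
    = if qdeg c == qdeg b then edge_coef s true p (tagged b) (tagged c) else 0.
  move=> cov; have [agr|/negPf] := boolP (agree p (tagged b) (tagged c)); last first.
    by rewrite /edge_coef /agree => ->; rewrite if_same.
  have [t [X [Y [edgeE qE _ _]]]] := edge_degree cov agr.
  have -> : (qdeg c == qdeg b) = (X == Y) by rewrite qE; lia.
  by rewrite !edgeE /exp_eq; case: (eqVneq X Y) => [->|_]; rewrite ?eqxx // mulr0.
rewrite /diff_coef; case: ifP => qE.
  by apply: eq_bigr => p /edgeE->; rewrite qE.
by apply: big1 => p /edgeE->; rewrite qE mulr0.
Qed.
End Differential.

Theorem theoremC (G : ribbonGraph) (l : nat) (M : l.-tuple {set dart G})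
    (k : comPzRingType) (n : nat) (sqrtn : k) :
  connected G -> trivalent G -> perfect_matching M ->
  (0 < n)%N -> sqrtn ^+ 2 = n%:R ->
  exists E : spectralSequence k n,
    [/\ attached (@hdeg G l M n) (@qdeg G l M n) (fdiff M n sqrtn) E,
        forall i j : int, lmod_iso (page E 1 i j) (CH M n sqrtn i j)
      & Einfty_iso E (gr_hatCH M n sqrtn)].
Proof.
move=> _ triv pm n_gt0 s2.
have deg := diff_coef_degree (M := M) triv pm n_gt0 (s := sqrtn).
have deg0 := diff_coef_unfiltered (M := M) triv pm n_gt0 sqrtn.
have DD := fdiff_square triv pm n_gt0 s2.
exists (filtered_sseq n_gt0 deg DD); split.
- exact: filtered_sseq_attached.
- exact: (filtered_sseq_E1 n_gt0 deg deg0 DD).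
- exact: filtered_sseq_Einfty.
Qed.
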